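(* There exist $T\in(0,\infty)$, two sequences of drivers $\xi_n,\tilde\xi_n\in S_0([0,T])$ with $\|\xi_n-\tilde\xi_n\|_{\infty[0,T]}\to0$, points $y_n\in\mathbb{R}$, and a fixed $\epsilon>0$ such that for all $n$, $$\tau(y_n;\xi_n)<\infty,\qquad \tau(y_n;\tilde\xi_n)<\infty,\qquad |\tau(y_n;\xi_n)-\tau(y_n;\tilde\xi_n)|\ge\epsilon.$$
   Context: A driver is a continuous function $\xi:[0,T]\to\mathbb{R}$. The upwards Loewner flow of $\xi$ in the upper half plane $\mathbb{H}$ is the solution of $\partial_t h_t(z)=\frac{-2}{h_t(z)-\xi(t)}$, $h_0(z)=z$; for $z\in\mathbb{H}$ it exists on all of $[0,T]$. Hitting times: for $x\in\mathbb{R}\setminus\{\xi(0)\}$, let $x(t)=h_t(x;\xi)$ be the real solution of the same ODE started at $x$, and let $\tau(x;\xi):=\inf\{t\ge 0: \liminf_{s\nearrow t}|x(s)-\xi(s)|=0\}$ (with $t\in[0,T]$ and $\inf\emptyset=+\infty$); also $\tau(\xi(0);\xi)=0$. Simple-curve drivers: $S([0,T])$ is the set of continuous $\xi:[0,T]\to\mathbb{R}$ that generate a simple curve, i.e. there is an injective continuous $\gamma:[0,T]\to\mathbb{H}\cup\{\xi(T)\}$ with $\gamma(0)=\xi(T)$ and $\gamma((0,T])\subset\mathbb{H}$ such that $h_T$ maps $\mathbb{H}$ conformally onto $\mathbb{H}\setminus\gamma((0,T])$. $S_0([0,T])$ is the set of $\xi\in S([0,T])$ with $\xi(0)=0$.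 *)

(* Defs.v *)
From Stdlib Require Import Reals.
From Coquelicot Require Import Coquelicot.
Open Scope R_scope.

(** Drivers, flows and curves are total functions, of which only the values on
    the relevant time interval (or on the upper half-plane) are ever used. *)

Definition Icc (a b : R) : R -> Prop := fun t => a <= t <= b.
Definition Ico (a b : R) : R -> Prop := fun t => a <= t < b.

Definition upper_half_plane (z : C) : Prop := 0 < Im z.

(** Derivative at [t] relative to [D]; one-sided at an end point of an
    interval [D]. *)
Definition is_derive_within {V : NormedModule R_AbsRing}
    (D : R -> Prop) (f : R -> V) (t : R) (l : V) : Prop :=
  filterdiff f (within D (locally t)) (fun h : R => scal h l).

(** [C_R_NormedModule] is the real normed space [C]: the time derivative is
    that of a complex-valued function of a real variable. The condition
    [g t <> xi t] is explicit because division is total. *)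
Definition is_loewner_solution (D : R -> Prop) (xi : R -> R)
    (z : C) (g : R -> C) : Prop :=
  g 0 = z /\
  forall t, D t ->
    g t <> RtoC (xi t) /\
    is_derive_within (V := C_R_NormedModule) D g t
      (RtoC (-2) / (g t - RtoC (xi t)))%C.

Definition is_real_loewner_solution (D : R -> Prop) (xi : R -> R)
    (x : R) (g : R -> R) : Prop :=
  g 0 = x /\
  forall t, D t ->
    g t <> xi t /\
    is_derive_within (V := R_NormedModule) D g t (-2 / (g t - xi t)).

(** [liminf_(s -> t, s < t, s in D) f s], as the supremum over [delta > 0] of
    the infima of [f] on [D /\ (t - delta, t)]; it is [p_infty] if [t] is not
    a left limit point of [D]. *)
Definition LimInf_left (D : R -> Prop) (f : R -> R) (t : R) : Rbar :=
  Rbar_lub (fun v => exists delta, 0 < delta /\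
    v = Glb_Rbar (fun y => exists s, D s /\ t - delta < s < t /\ y = f s)).

(** The solution started at [x] need not exist on all of [[0,T]], so [t] is a
    hitting time when the solution exists (at least) on [[0,t)] and the
    liminf at [t] vanishes; solutions are unique while they avoid the driver.
    The infimum of the empty set is [p_infty]. *)
Definition is_hitting (T : R) (xi : R -> R) (x t : R) : Prop :=
  Icc 0 T t /\
  exists g : R -> R,
    is_real_loewner_solution (Ico 0 t) xi x g /\
    LimInf_left (Ico 0 t) (fun s => Rabs (g s - xi s)) t = Finite 0.

Definition hitting_time (T : R) (xi : R -> R) (x : R) : Rbar :=
  if Req_EM_T x (xi 0) then Finite 0 else Glb_Rbar (is_hitting T xi x).

Definition conformal_onto (U V : C -> Prop) (f : C -> C) : Prop :=
  (forall z, U z -> ex_derive (K := C_AbsRing) (V := C_NormedModule) f z) /\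
  (forall z w, U z -> U w -> f z = f w -> z = w) /\
  (forall w, V w <-> exists z, U z /\ f z = w).

Definition generates_simple_curve (T : R) (xi : R -> R) : Prop :=
  exists (h : R -> C -> C) (gamma : R -> C),
    (forall z, upper_half_plane z ->
       is_loewner_solution (Icc 0 T) xi z (fun t => h t z)) /\
    continuous_on (Icc 0 T) gamma /\
    (forall s t, Icc 0 T s -> Icc 0 T t -> gamma s = gamma t -> s = t) /\
    gamma 0 = RtoC (xi T) /\
    (forall t, 0 < t <= T -> upper_half_plane (gamma t)) /\
    conformal_onto upper_half_plane
      (fun w => upper_half_plane w /\ ~ exists t, 0 < t <= T /\ w = gamma t)
      (h T).

Definition simple_drivers (T : R) (xi : R -> R) : Prop :=
  continuous_on (Icc 0 T) xi /\ generates_simple_curve T xi.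

Definition simple_drivers0 (T : R) (xi : R -> R) : Prop :=
  simple_drivers T xi /\ xi 0 = 0.

(** Real-valued: used only for continuous functions on [[0,T]], [0 < T], for
    which the supremum is finite. *)
Definition sup_norm (T : R) (f : R -> R) : R :=
  real (Lub_Rbar (fun y => exists t, Icc 0 T t /\ y = Rabs (f t))).

(* Main.v *)
Require Import Defs.
From Stdlib Require Import Reals Psatz ClassicalEpsilon Ranalysis5.
From Coquelicot Require Import Coquelicot.
Open Scope R_scope.

(** Seen from the driver, a real point is pulled in by [- 2 / X], while a driver
    moving away like [- 4 sqrt t] keeps its distance from a point at [2 sqrt t]:
    such a driver can save, for a macroscopic time, a point that it would
    swallow at once if it stood still. This is exploited at a small scale [d].
    Prescribe the gap [X = sqrt (4 (t + d) (1 - t) / (1 + d))], which is of order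
    [sqrt d] at time [0], positive before time [1] and [0] at time [1]; the
    driver with [xi' = - 2 / X - X'] swallows the point [y = X 0] exactly at
    time [1]. The second driver stands still until time [d], hence swallows [y]
    before that time, and then takes over the speed of the first; the two differ
    by at most [4 sqrt d]. So the hitting times of [y] stay [1 / 2] apart, while
    the drivers merge as [d] tends to [0]. That no solution hits earlier than
    [X] is [gap_unique].

    For fixed [d] both drivers have a bounded continuous derivative [v], and
    such drivers generate simple curves
    ([simple_curve_of_bounded_derivative]). In coordinates centred at the
    driver, [Z = X + i Y] solves [Z' = - 2 / Z - v]. Run backward from a point of
    the half-plane at time [T], either the solution lasts until time [0], and
    the point is in the image of [h_T], or it dies at a time [s] by reaching the
    driver ([backward_dichotomy]). The curve consists of the points of the
    second kind, and its tip at parameter [t] is the one that dies at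
    [s = T - t]. That there is exactly one such point for each [s]
    ([emerging_exists], [emerges_unique]), depending continuously on [s], all
    follows from one estimate, [fan_stability]: a solution that leaves the
    driver rises within 45 degrees of the vertical at first, because the
    singular drift dominates the bounded [v]; and there the difference [D] of two
    solutions, which satisfies [D' = 2 D / (Z1 Z2)], is contracted. The same
    equation for [D] yields the complex derivative of [h_T] by linearization
    ([linearization_error_bound]). *)

(** * Integral curves of a bounded Lipschitz field *)

Lemma continuous_Lipschitz {V : NormedModule R_AbsRing} (f : R -> V) (M : R) :
  (forall a b, norm (minus (f b) (f a)) <= M * Rabs (b - a)) ->
  forall t, continuous f t.
Proof.
  intros H t. apply filterlim_locally. intros eps.
  assert (HM : 0 < Rabs M + 1) by (pose proof (Rabs_pos M); lra).
  assert (Hd : 0 < eps / (Rabs M + 1)) by (apply Rdiv_lt_0_compat; [apply cond_pos | lra]).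
  exists (mkposreal _ Hd). intros s Hs.
  apply norm_compat1. apply Rle_lt_trans with (1 := H t s).
  change (Rabs (s - t) < eps / (Rabs M + 1)) in Hs.
  apply Rle_lt_trans with (Rabs M * Rabs (s - t)).
  - apply Rmult_le_compat_r; [apply Rabs_pos | apply Rle_abs].
  - apply Rle_lt_trans with ((Rabs M + 1) * Rabs (s - t)).
    + pose proof (Rabs_pos (s - t)). nra.
    + apply Rlt_le_trans with ((Rabs M + 1) * (eps / (Rabs M + 1))).
      * apply Rmult_lt_compat_l; assumption.
      * right. field. lra.
Qed.

Lemma continuous_ex_RInt {V : CompleteNormedModule R_AbsRing} (f : R -> V) (a b : R) :
  (forall t, continuous f t) -> ex_RInt f a b.
Proof. intros H. apply (ex_RInt_continuous f). intros; apply H. Qed.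

Lemma is_derive_RInt_upper {V : CompleteNormedModule R_AbsRing} (f : R -> V) (a t : R) :
  (forall t, continuous f t) -> is_derive (fun s => RInt f a s) t (f t).
Proof.
  intros H. apply is_derive_RInt with a; [| apply H].
  apply filter_forall. intros s. apply (RInt_correct f), continuous_ex_RInt, H.
Qed.

(** Stated with a primitive of the bound, the estimate holds on both sides of
    the base point. *)
Lemma norm_RInt_le_primitive {V : CompleteNormedModule R_AbsRing}
    (f : R -> V) (g g' : R -> R) (a b : R) :
  (forall t, continuous f t) -> (forall t, continuous g' t) ->
  (forall t, is_derive g t (g' t)) -> (forall t, norm (f t) <= g' t) ->
  norm (RInt f a b) <= Rabs (g b - g a).
Proof.
  intros Hf Hg' Hg Hle.
  assert (main : forall c d, c <= d -> norm (RInt f c d) <= Rabs (g d - g c)).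
  { intros c d Hcd.
    apply Rle_trans with (g d - g c); [| apply Rle_abs].
    apply (norm_RInt_le f g' c d); auto.
    - apply (RInt_correct f), continuous_ex_RInt, Hf.
    - apply (is_RInt_derive g g'); intros; auto. }
  destruct (Rle_dec a b) as [Hab | Hab]; [now apply main |].
  rewrite <- (opp_RInt_swap f b a); [| now apply continuous_ex_RInt].
  apply Rle_trans with (norm (RInt f b a)); [right; apply @norm_opp |].
  rewrite Rabs_minus_sym. apply main. lra.
Qed.

Lemma minus_plus_l {G : AbelianGroup} (u a : G) : minus (plus u a) u = a.
Proof.
  unfold minus.
  transitivity (plus (plus a u) (opp u)); [f_equal; apply plus_comm |].
  transitivity (plus a (plus u (opp u))); [symmetry; apply plus_assoc |].
  transitivity (plus a zero); [f_equal; apply plus_opp_r | apply plus_zero_r].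
Qed.

Lemma minus_plus_plus {G : AbelianGroup} (u a b : G) :
  minus (plus u a) (plus u b) = minus a b.
Proof.
  rewrite (minus_trans u), minus_plus_l.
  apply (f_equal (plus a)).
  rewrite <- (opp_minus (plus u b) u). apply f_equal, minus_plus_l.
Qed.

Lemma norm_minus_diag {V : NormedModule R_AbsRing} (x : V) : norm (minus x x) = 0.
Proof. rewrite minus_eq_zero. apply @norm_zero. Qed.

Lemma eq_of_norm_minus_le_0 {V : NormedModule R_AbsRing} (x y : V) :
  norm (minus x y) <= 0 -> x = y.
Proof.
  intros H. apply (plus_reg_r (opp y)). rewrite plus_opp_r.
  apply norm_eq_zero, Rle_antisym; [exact H | apply norm_ge_0].
Qed.

Lemma norm_minus_sym {V : NormedModule R_AbsRing} (x y : V) :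
  norm (minus x y) = norm (minus y x).
Proof. rewrite <- (opp_minus y x). apply norm_opp. Qed.

Lemma norm_minus_triangle {V : NormedModule R_AbsRing} (x y z : V) :
  norm (minus x z) <= norm (minus x y) + norm (minus y z).
Proof. rewrite (minus_trans y x z). apply @norm_triangle. Qed.

Lemma norm_minus_limit_le {V : NormedModule R_AbsRing} (a : nat -> V) (l x : V) (c : R) (N : nat) :
  filterlim a eventually (locally l) ->
  (forall n, (N <= n)%nat -> norm (minus (a n) x) <= c) -> norm (minus l x) <= c.
Proof.
  intros Ha Hc.
  assert (Hl : filterlim (fun n => norm (minus (a n) x)) eventually
                 (Rbar_locally (norm (minus l x)))).
  { apply (filterlim_comp _ _ _ a (fun y : V => norm (minus y x)) eventually (locally l)); auto.
    apply (continuous_comp (fun y : V => minus y x) norm).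
    - apply (continuous_minus (fun y : V => y) (fun _ => x)).
      + apply continuous_id.
      + apply continuous_const.
    - apply filterlim_norm. }
  apply (filterlim_le (F := eventually) (fun n => norm (minus (a n) x)) (fun _ => c)
           (Finite (norm (minus l x))) (Finite c)); auto.
  - exists N. apply Hc.
  - apply filterlim_const.
Qed.

Section Picard.

Context {V : CompleteNormedModule R_AbsRing}.
Variables (F : R -> V -> V) (K M : R) (u0 : V).
Hypothesis K_pos : 0 < K.
Hypothesis F_cont : forall u : R -> V,
  (forall t, continuous u t) -> forall t, continuous (fun s => F s (u s)) t.
Hypothesis F_lip : forall t x y,
  norm (minus (F t x) (F t y)) <= K * norm (minus x y).
Hypothesis F_bnd : forall t x, norm (F t x) <= M.

Fixpoint picard (n : nat) (t : R) : V :=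
  match n with
  | O => u0
  | S n => plus u0 (RInt (fun s => F s (picard n s)) 0 t)
  end.

(** The increments of the Picard iteration are measured against this weight:
    its primitive from [0] is at most the weight itself divided by [2 * K], on
    both sides of [0], so that every iteration gains a factor [1/2]. *)
Let W (t : R) := exp (2 * K * t) + exp (- (2 * K * t)).
Let P (t : R) := (exp (2 * K * t) - exp (- (2 * K * t))) / (2 * K).

Lemma picard_weight_pos t : 0 < W t.
Proof. unfold W. pose proof (exp_pos (2*K*t)). pose proof (exp_pos (-(2*K*t))). lra. Qed.

Lemma picard_weight_primitive t : is_derive P t (W t).
Proof. unfold P, W. auto_derive; [lra |]. field. lra. Qed.

Lemma picard_weight_continuous t : continuous W t.
Proof.
  apply (ex_derive_continuous W). unfold W. auto_derive. trivial.
Qed.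

Lemma picard_primitive_le t : Rabs (P t - P 0) <= W t / (2 * K).
Proof.
  unfold P, W. rewrite !Rmult_0_r, Ropp_0.
  replace (_ - _) with ((exp (2*K*t) - exp (-(2*K*t))) / (2*K)) by (field; lra).
  unfold Rdiv. rewrite Rabs_mult, (Rabs_pos_eq (/ (2*K))).
  2: { left. apply Rinv_0_lt_compat. lra. }
  apply Rmult_le_compat_r. { left. apply Rinv_0_lt_compat. lra. }
  pose proof (exp_pos (2*K*t)). pose proof (exp_pos (-(2*K*t))).
  apply Rabs_le. lra.
Qed.

Lemma picard_abs_le_weight t : Rabs t <= W t / (2 * K).
Proof.
  apply Rmult_le_reg_l with (2 * K); [lra |].
  replace (2 * K * (W t / (2*K))) with (W t) by (field; lra).
  unfold W. pose proof (exp_pos (2*K*t)). pose proof (exp_pos (-(2*K*t))).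
  pose proof (exp_ineq1_le (2*K*t)). pose proof (exp_ineq1_le (-(2*K*t))).
  unfold Rabs. destruct (Rcase_abs t); lra.
Qed.

Lemma picard_bound_nonneg : 0 <= M.
Proof. apply Rle_trans with (2 := F_bnd 0 u0). apply norm_ge_0. Qed.

Lemma picard_RInt_Lipschitz (u : R -> V) :
  (forall t, continuous u t) -> forall a b,
  norm (minus (plus u0 (RInt (fun s => F s (u s)) 0 b))
              (plus u0 (RInt (fun s => F s (u s)) 0 a))) <= M * Rabs (b - a).
Proof.
  intros Hu a b.
  pose proof (F_cont u Hu) as Hc.
  replace (minus _ _) with (RInt (fun s => F s (u s)) a b).
  - rewrite Rmult_comm. apply (norm_RInt_le_const_abs (fun s => F s (u s)) a b).
    + intros; apply F_bnd.
    + apply (RInt_correct (fun s => F s (u s))), continuous_ex_RInt, Hc.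
  - symmetry. etransitivity; [apply (minus_plus_plus (G := V)) |].
    rewrite <- (RInt_Chasles (fun s => F s (u s)) 0 a b) by (now apply continuous_ex_RInt).
    apply (minus_plus_l (G := V)).
Qed.

Lemma picard_continuous n : forall t, continuous (picard n) t.
Proof.
  induction n as [| n IH]; simpl.
  - intros t. apply continuous_const.
  - apply (continuous_Lipschitz (V := V) _ M). now apply picard_RInt_Lipschitz.
Qed.

Lemma picard_Lipschitz n a b :
  norm (minus (picard n b) (picard n a)) <= M * Rabs (b - a).
Proof.
  destruct n as [| n]; simpl.
  - rewrite (norm_minus_diag (V := V)). pose proof picard_bound_nonneg.
    pose proof (Rabs_pos (b - a)). nra.
  - apply picard_RInt_Lipschitz. apply picard_continuous.
Qed.

Lemma RInt_field_diff_le (u w : R -> V) (c : R) :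
  (forall t, continuous u t) -> (forall t, continuous w t) ->
  (forall t, norm (minus (u t) (w t)) <= c * W t) ->
  forall t, norm (minus (plus u0 (RInt (fun s => F s (u s)) 0 t))
                        (plus u0 (RInt (fun s => F s (w s)) 0 t))) <= c / 2 * W t.
Proof.
  intros Hu Hw Hd t.
  pose proof (F_cont u Hu) as Hcu. pose proof (F_cont w Hw) as Hcw.
  assert (Hc : 0 <= c).
  { pose proof (picard_weight_pos 0). pose proof (Hd 0).
    pose proof (norm_ge_0 (minus (u 0) (w 0))). nra. }
  replace (minus _ _) with (RInt (fun s => minus (F s (u s)) (F s (w s))) 0 t).
  - apply Rle_trans with (Rabs ((K * c) * P t - (K * c) * P 0)).
    + apply (norm_RInt_le_primitive _ (fun t => (K * c) * P t) (fun t => (K * c) * W t)).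
      * intros s. now apply (continuous_minus (V := V) (fun s => F s (u s)) (fun s => F s (w s))).
      * intros s. apply (continuous_scal_r (K * c) W), picard_weight_continuous.
      * intros s. apply (is_derive_scal P), picard_weight_primitive.
      * intros s. apply Rle_trans with (1 := F_lip _ _ _).
        rewrite Rmult_assoc. apply Rmult_le_compat_l; [lra | apply Hd].
    + rewrite <- Rmult_minus_distr_l, Rabs_mult, (Rabs_pos_eq (K * c)) by nra.
      apply Rle_trans with ((K * c) * (W t / (2 * K))).
      * apply Rmult_le_compat_l; [nra | apply picard_primitive_le].
      * right. field. lra.
  - rewrite (RInt_minus (fun s => F s (u s)) (fun s => F s (w s))) by (now apply continuous_ex_RInt).
    symmetry. apply (minus_plus_plus (G := V)).
Qed.

Lemma picard_increment n t :
  norm (minus (picard (S n) t) (picard n t)) <= M / (2 * K) * (1 / 2) ^ n * W t.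
Proof.
  pose proof picard_bound_nonneg.
  revert t. induction n as [| n IH]; intros t.
  - simpl picard at 2. rewrite pow_O, Rmult_1_r.
    assert (Hc : forall s, continuous (fun s => F s u0) s).
    { apply F_cont. intros; apply continuous_const. }
    replace (minus _ _) with (RInt (fun s => F s u0) 0 t).
    2: { symmetry. simpl. apply (minus_plus_l (G := V)). }
    apply Rle_trans with (Rabs (t - 0) * M).
    + apply (norm_RInt_le_const_abs (fun s => F s u0)); [intros; apply F_bnd |].
      apply (RInt_correct (fun s => F s u0)), continuous_ex_RInt, Hc.
    + rewrite Rminus_0_r. pose proof (picard_abs_le_weight t).
      apply Rle_trans with (W t / (2*K) * M); [nra |]. right. field. lra.
  - replace (M / (2 * K) * (1 / 2) ^ S n * W t)
      with (M / (2 * K) * (1 / 2) ^ n / 2 * W t) by (simpl; field; lra).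
    simpl. apply RInt_field_diff_le; auto using picard_continuous.
    apply (picard_continuous (S n)).
Qed.

Lemma picard_cauchy n k t :
  norm (minus (picard (n + k) t) (picard n t)) <= M / K * (1 / 2) ^ n * W t.
Proof.
  pose proof (picard_weight_pos t) as HW. pose proof picard_bound_nonneg as HM.
  assert (HMK : 0 <= M / K) by (apply Rdiv_le_0_compat; lra).
  assert (H : norm (minus (picard (n + k) t) (picard n t))
              <= M / K * ((1 / 2) ^ n * (1 - (1 / 2) ^ k)) * W t).
  { induction k as [| k IH].
    - rewrite Nat.add_0_r, (norm_minus_diag (V := V)). simpl. lra.
    - rewrite Nat.add_succ_r.
      apply Rle_trans with (1 := norm_minus_triangle (V := V) _ (picard (n + k) t) _).
      pose proof (picard_increment (n + k) t) as Hi.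
      apply Rle_trans with (1 := Rplus_le_compat _ _ _ _ Hi IH).
      rewrite pow_add. simpl. right. field. lra. }
  apply Rle_trans with (1 := H).
  apply Rmult_le_compat_r; [lra |]. apply Rmult_le_compat_l; [lra |].
  assert (Hp : forall m, 0 <= (1/2)^m) by (intros; apply pow_le; lra).
  pose proof (Hp n). pose proof (Hp k). nra.
Qed.

Lemma geometric_lt (c eps : R) : 0 < eps -> exists n, c * (1 / 2) ^ n < eps.
Proof.
  intros He.
  assert (Hc : 0 < Rabs c + 1) by (pose proof (Rabs_pos c); lra).
  destruct (pow_lt_1_zero (1/2) ltac:(rewrite Rabs_pos_eq; lra) (eps / (Rabs c + 1))) as [n Hn].
  { apply Rdiv_lt_0_compat; lra. }
  exists n. specialize (Hn n (le_n n)).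
  assert (Hp : 0 < (1/2)^n) by (apply pow_lt; lra).
  rewrite Rabs_pos_eq in Hn by lra.
  apply Rle_lt_trans with ((Rabs c + 1) * (1/2)^n).
  - pose proof (Rle_abs c). nra.
  - apply Rlt_le_trans with ((Rabs c + 1) * (eps / (Rabs c + 1))).
    + now apply Rmult_lt_compat_l.
    + right. field. lra.
Qed.

Lemma picard_limit t : exists l, filterlim (fun n => picard n t) eventually (locally l).
Proof.
  apply (filterlim_locally_cauchy (U := V) (F := eventually) (fun n => picard n t)).
  intros eps.
  destruct (geometric_lt (M / K * W t * 2) eps (cond_pos eps)) as [n Hn].
  exists (fun m => (n <= m)%nat). split; [now exists n |].
  intros p q Hp Hq. apply (norm_compat1 (V := V)).
  apply Rle_lt_trans with (1 := norm_minus_triangle (V := V) _ (picard n t) _).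
  replace p with (n + (p - n))%nat by lia. replace q with (n + (q - n))%nat by lia.
  rewrite (norm_minus_sym (V := V) (picard n t)).
  apply Rle_lt_trans with (1 := Rplus_le_compat _ _ _ _ (picard_cauchy n (q - n) t)
                                  (picard_cauchy n (p - n) t)).
  lra.
Qed.

(** All iterates have the Lipschitz constant [M], and so has their limit: this
    gives its continuity, which the integral equation requires, from pointwise
    convergence alone. *)
Theorem picard_lindelof_0 :
  exists u : R -> V, u 0 = u0 /\ forall t, is_derive u t (F t (u t)).
Proof.
  destruct (choice (fun t l => filterlim (fun n => picard n t) eventually (locally l))
              picard_limit) as [u Hu].
  assert (Hd : forall n t, norm (minus (u t) (picard n t)) <= M / K * (1/2) ^ n * W t).
  { intros n t. apply (norm_minus_limit_le (V := V) (fun n => picard n t)) with n; auto.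
    intros m Hm. replace m with (n + (m - n))%nat by lia. apply picard_cauchy. }
  assert (Hlip : forall a b, norm (minus (u b) (u a)) <= M * Rabs (b - a)).
  { intros a b. apply le_epsilon. intros eps He.
    destruct (geometric_lt (M / K * W a + M / K * W b) eps He) as [n Hn].
    apply Rle_trans with (1 := norm_minus_triangle (V := V) _ (picard n b) _).
    assert (H1 := norm_minus_triangle (V := V) (picard n b) (picard n a) (u a)).
    rewrite (norm_minus_sym (V := V) (picard n a)) in H1.
    apply Rle_trans with (1 := Rplus_le_compat _ _ _ _ (Hd n b) H1).
    pose proof (Rplus_le_compat _ _ _ _ (picard_Lipschitz n a b) (Hd n a)) as H2.
    apply Rle_trans with (1 := Rplus_le_compat_l _ _ _ H2). lra. }
  assert (Hc : forall t, continuous u t) by (now apply (continuous_Lipschitz (V := V) _ M)).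
  set (w := fun t => plus u0 (RInt (fun s => F s (u s)) 0 t)).
  assert (Heq : forall t, u t = w t).
  { intros t. apply (eq_of_norm_minus_le_0 (V := V)), le_epsilon. intros eps He.
    destruct (geometric_lt (M / K * W t) eps He) as [n Hn].
    rewrite Rplus_0_l. left.
    apply Rle_lt_trans with (1 := norm_minus_triangle (V := V) _ (picard (S n) t) _).
    assert (H2 : norm (minus (picard (S n) t) (w t)) <= (M / K * (1/2)^n) / 2 * W t).
    { apply RInt_field_diff_le; auto using picard_continuous.
      intros s. rewrite (norm_minus_sym (V := V)). apply Hd. }
    apply Rle_lt_trans with (1 := Rplus_le_compat _ _ _ _ (Hd (S n) t) H2).
    simpl. lra. }
  exists u. split.
  - rewrite Heq. unfold w. rewrite RInt_point. apply plus_zero_r.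
  - intros t. apply (is_derive_ext (V := V) w); [intros; symmetry; apply Heq |].
    unfold w. replace (F t (u t)) with (plus zero (F t (u t))) by apply (plus_zero_l (G := V)).
    apply (is_derive_plus (V := V) (fun _ => u0)).
    + apply (is_derive_const (V := V)).
    + apply (is_derive_RInt_upper (fun s => F s (u s))), F_cont, Hc.
Qed.

End Picard.

Theorem picard_lindelof {V : CompleteNormedModule R_AbsRing}
    (F : R -> V -> V) (K M t0 : R) (u0 : V) :
  0 < K ->
  (forall u : R -> V, (forall t, continuous u t) ->
     forall t, continuous (fun s => F s (u s)) t) ->
  (forall t x y, norm (minus (F t x) (F t y)) <= K * norm (minus x y)) ->
  (forall t x, norm (F t x) <= M) ->
  exists u : R -> V, u t0 = u0 /\ forall t, is_derive u t (F t (u t)).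
Proof.
  intros HK Hc Hl Hb.
  assert (shift : forall (a t : R), is_derive (fun s : R => s + a) t 1).
  { intros a t. auto_derive; trivial. }
  destruct (picard_lindelof_0 (fun s x => F (s + t0) x) K M u0) as [u [Hu0 Hu]]; auto.
  - intros u Hu t.
    apply (continuous_ext (fun s => (fun r => F r (u (r - t0))) (s + t0))).
    { intros s. f_equal. f_equal. simpl. ring. }
    apply (continuous_comp (fun s => s + t0) (fun r => F r (u (r - t0)))).
    + apply (ex_derive_continuous (fun s : R => s + t0)). eexists; apply shift.
    + apply Hc. intros s. apply (continuous_comp (fun r => r - t0) u); [| apply Hu].
      apply (ex_derive_continuous (fun s : R => s - t0)). eexists; apply shift.
  - exists (fun t => u (t - t0)). split.
    + now rewrite Rminus_diag.
    + intros t. replace (F t (u (t - t0))) with (scal 1 (F t (u (t - t0)))) by apply (scal_one (V := V)).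
      apply (is_derive_comp (V := V) u (fun s => s - t0)); [| apply shift].
      replace t with ((t - t0) + t0) at 2 by ring. apply Hu.
Qed.

(** * Comparison principles for real functions on an interval *)

Lemma is_derive_continuous (f : R -> R) (t l : R) : is_derive f t l -> continuous f t.
Proof. intros H. apply (ex_derive_continuous f). now exists l. Qed.

Lemma nondecreasing_of_derive (f f' : R -> R) (a b : R) :
  a <= b -> (forall t, a <= t <= b -> is_derive f t (f' t)) ->
  (forall t, a <= t <= b -> 0 <= f' t) -> f a <= f b.
Proof.
  intros Hab Hd Hp.
  destruct (MVT_gen f a b f') as [c [Hc E]]; rewrite ?Rmin_left, ?Rmax_right in * by lra.
  - intros x Hx. apply Hd. lra.
  - intros x Hx. apply continuity_pt_filterlim.
    apply (is_derive_continuous f x (f' x)), Hd. lra.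
  - pose proof (Hp c Hc). nra.
Qed.

Lemma exp_monotone (a b : R) : a <= b -> exp a <= exp b.
Proof.
  intros [H | ->]; [left; now apply exp_increasing | apply Rle_refl].
Qed.

Lemma gronwall_forward (f f' : R -> R) (K a b : R) :
  a <= b -> (forall t, a <= t <= b -> is_derive f t (f' t)) ->
  (forall t, a <= t <= b -> f' t <= K * f t) -> f b <= exp (K * (b - a)) * f a.
Proof.
  intros Hab Hd Hp.
  assert (H : - (f a * exp (K * (b - a))) <= - (f b * exp (K * (b - b)))).
  { apply (nondecreasing_of_derive (fun t => - (f t * exp (K * (b - t))))
      (fun t => (K * f t - f' t) * exp (K * (b - t))) a b Hab).
    - intros t Ht. auto_derive.
      + exists (f' t). now apply Hd.
      + rewrite (is_derive_unique (fun x : R => f x) t _ (Hd t Ht)). unfold Rminus. ring.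
    - intros t Ht. apply Rmult_le_pos; [specialize (Hp t Ht); lra |].
      left; apply exp_pos. }
  rewrite Rminus_diag, Rmult_0_r, exp_0 in H. lra.
Qed.

Lemma gronwall_backward (f f' : R -> R) (K a b : R) :
  a <= b -> (forall t, a <= t <= b -> is_derive f t (f' t)) ->
  (forall t, a <= t <= b -> - (K * f t) <= f' t) -> f a <= exp (K * (b - a)) * f b.
Proof.
  intros Hab Hd Hp.
  assert (H : f a * exp (K * (a - a)) <= f b * exp (K * (b - a))).
  { apply (nondecreasing_of_derive (fun t => f t * exp (K * (t - a)))
      (fun t => (K * f t + f' t) * exp (K * (t - a))) a b Hab).
    - intros t Ht. auto_derive.
      + exists (f' t). now apply Hd.
      + rewrite (is_derive_unique (fun x : R => f x) t _ (Hd t Ht)). unfold Rminus. ring.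
    - intros t Ht. apply Rmult_le_pos; [specialize (Hp t Ht); lra |].
      left; apply exp_pos. }
  rewrite Rminus_diag, Rmult_0_r, exp_0 in H. lra.
Qed.

(** A function cannot cross a level that it can only meet while decreasing:
    at the last time before [b] at which [f <= 0] the derivative would have to
    be nonnegative. *)
Lemma barrier_forward (f f' : R -> R) (a b : R) :
  a <= b -> (forall t, a <= t <= b -> is_derive f t (f' t)) ->
  (forall t, a <= t <= b -> f t = 0 -> f' t < 0) -> f a <= 0 -> f b <= 0.
Proof.
  intros Hab Hd Hn Ha.
  destruct (Rle_dec (f b) 0) as [| Hb]; [assumption | exfalso].
  set (E := fun t => a <= t <= b /\ f t <= 0).
  destruct (completeness E) as [s [Hub Hlub]].
  { exists b. intros t [Ht _]. lra. }
  { exists a. split; lra. }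
  assert (Has : a <= s) by (apply Hub; split; lra).
  assert (Hsb : s <= b) by (apply Hlub; intros t [Ht _]; lra).
  assert (Hs : a <= s <= b) by lra.
  assert (Hcont : continuous f s) by (apply (is_derive_continuous f s (f' s)); auto).
  assert (Hafter : forall t, s < t <= b -> 0 < f t).
  { intros t Ht. apply Rnot_le_lt. intros Hle.
    assert (t <= s) by (apply Hub; split; lra). lra. }
  assert (Hfs : f s <= 0).
  { apply Rnot_lt_le. intros Hpos.
    assert (Hloc : locally s (fun t => 0 < f t)).
    { apply (Hcont (fun y => 0 < y)). now apply (open_gt 0). }
    destruct Hloc as [d Hdl].
    assert (s <= s - d).
    { apply Hlub. intros t [Ht Hft]. apply Rnot_lt_le. intros Hlt.
      assert (t <= s) by (apply Hub; split; lra).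
      assert (0 < f t); [| lra]. apply Hdl.
      change (Rabs (t - s) < d). rewrite Rabs_left1; lra. }
    pose proof (cond_pos d). lra. }
  assert (Hlt : s < b).
  { destruct (Rle_lt_or_eq_dec s b Hsb); [assumption | subst; lra]. }
  assert (Hfs0 : f s = 0).
  { apply Rle_antisym; [assumption |]. apply Rnot_lt_le. intros Hneg.
    assert (Hloc : locally s (fun t => f t < 0)).
    { apply (Hcont (fun y => y < 0)). now apply (open_lt 0). }
    destruct Hloc as [d Hdl]. pose proof (cond_pos d).
    assert (Hm : s < s + Rmin (d / 2) (b - s) <= b).
    { split; [| pose proof (Rmin_r (d/2) (b - s)); lra].
      assert (0 < Rmin (d / 2) (b - s)) by (apply Rmin_glb_lt; lra). lra. }
    assert (f (s + Rmin (d / 2) (b - s)) < 0).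
    { apply Hdl. change (Rabs (s + Rmin (d / 2) (b - s) - s) < d).
      rewrite Rabs_right; pose proof (Rmin_l (d/2) (b - s)); lra. }
    specialize (Hafter _ Hm). lra. }
  specialize (Hn s Hs Hfs0).
  pose proof (Hd s Hs) as Hds. apply is_derive_Reals in Hds.
  destruct (Hds (- f' s) ltac:(lra)) as [d Hdd]. pose proof (cond_pos d).
  set (h := Rmin (d / 2) (b - s)).
  assert (0 < h) by (apply Rmin_glb_lt; lra).
  assert (h <= d / 2) by apply Rmin_l. assert (h <= b - s) by apply Rmin_r.
  specialize (Hdd h ltac:(lra) ltac:(rewrite Rabs_right; lra)).
  rewrite Hfs0, Rminus_0_r in Hdd. apply Rabs_def2 in Hdd.
  assert (0 < f (s + h)) by (apply Hafter; lra).
  assert (0 < f (s + h) / h) by (apply Rdiv_lt_0_compat; lra). lra.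
Qed.

Lemma barrier_backward (f f' : R -> R) (a b : R) :
  a <= b -> (forall t, a <= t <= b -> is_derive f t (f' t)) ->
  (forall t, a <= t <= b -> f t = 0 -> 0 < f' t) -> f b <= 0 -> f a <= 0.
Proof.
  intros Hab Hd Hp Hb.
  pose proof (barrier_forward (fun t => f (- t)) (fun t => - f' (- t)) (- b) (- a)) as H.
  simpl in H. rewrite !Ropp_involutive in H. apply H; auto; try lra.
  - intros t Ht. auto_derive.
    + exists (f' (- t)). apply Hd. lra.
    + rewrite (is_derive_unique (fun x : R => f x) (- t) _ (Hd (- t) ltac:(lra))). ring.
  - intros t Ht Hf. specialize (Hp (- t) ltac:(lra) Hf). lra.
Qed.

(** * The Loewner equation centred at the driver *)

(** [Z = X + i Y] solves [Z' = - 2 / Z - v]: this is the Loewner equation of a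
    driver [xi] with derivative [v], in the coordinate [Z = h_t - xi]. *)
Definition flows_at (v X Y : R -> R) (t : R) : Prop :=
  0 < Y t /\
  is_derive X t (- 2 * X t / (X t ^ 2 + Y t ^ 2) - v t) /\
  is_derive Y t (2 * Y t / (X t ^ 2 + Y t ^ 2)).

Definition trajectory (v : R -> R) (a b : R) (X Y : R -> R) : Prop :=
  forall t, a <= t <= b -> flows_at v X Y t.

Lemma trajectory_sub v a b a' b' X Y :
  a <= a' -> b' <= b -> trajectory v a b X Y -> trajectory v a' b' X Y.
Proof. intros Ha Hb H t Ht. apply H. lra. Qed.

Lemma norm_C_R (z : C) : norm (V := C_R_NormedModule) z = Cmod z.
Proof.
  unfold norm, Cmod; simpl. unfold prod_norm. f_equal.
  unfold norm; simpl. unfold abs; simpl.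
  f_equal; rewrite !Rmult_1_r, <- Rabs_mult; apply Rabs_pos_eq, Rle_0_sqr.
Qed.

Lemma is_derive_fst (u : R -> C) (t : R) (l : C) :
  is_derive (V := C_R_NormedModule) u t l -> is_derive (fun s => fst (u s)) t (fst l).
Proof.
  intros H.
  apply (filterdiff_ext_lin _ (fun y : R => fst (scal (V := C_R_NormedModule) y l))).
  - apply (filterdiff_comp' (K := R_AbsRing) (V := C_R_NormedModule) u fst t _ fst H).
    apply filterdiff_linear, (is_linear_fst (U := R_NormedModule) (V := R_NormedModule)).
  - reflexivity.
Qed.

Lemma is_derive_snd (u : R -> C) (t : R) (l : C) :
  is_derive (V := C_R_NormedModule) u t l -> is_derive (fun s => snd (u s)) t (snd l).
Proof.
  intros H.
  apply (filterdiff_ext_lin _ (fun y : R => snd (scal (V := C_R_NormedModule) y l))).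
  - apply (filterdiff_comp' (K := R_AbsRing) (V := C_R_NormedModule) u snd t _ snd H).
    apply filterdiff_linear, (is_linear_snd (U := R_NormedModule) (V := R_NormedModule)).
  - reflexivity.
Qed.

Lemma continuous_pair (f g : R -> R) (t : R) :
  continuous f t -> continuous g t ->
  continuous (U := C_R_NormedModule) (fun s => (f s, g s)) t.
Proof.
  intros Hf Hg. unfold continuous.
  apply (filterlim_filter_le_2 (F := locally t) (G := filter_prod (locally (f t)) (locally (g t)))).
  - intros P [d Hd]. exists (fun x => ball (f t) d x) (fun y => ball (g t) d y).
    + now exists d.
    + now exists d.
    + intros x y Hx Hy. apply Hd. now split.
  - now apply filterlim_pair.
Qed.

Lemma continuous_Rmax_l (c t : R) : continuous (fun y => Rmax y c) t.
Proof.
  apply (continuous_Lipschitz (fun y => Rmax y c) 1). intros a b.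
  change (Rabs (Rmax b c - Rmax a c) <= 1 * Rabs (b - a)).
  unfold Rmax, Rabs. repeat destruct Rle_dec; repeat destruct Rcase_abs; lra.
Qed.

(** Raising the imaginary part to at least [eps] makes the field bounded and
    Lipschitz, without changing it along the trajectories above height [eps]. *)
Definition truncation (eps : R) (z : C) : C := (fst z, Rmax (snd z) eps).

Definition truncated_field (v : R -> R) (eps : R) (t : R) (z : C) : C :=
  (RtoC (-2) / truncation eps z - RtoC (v t))%C.

Lemma Cmod_truncation eps z : 0 < eps -> eps <= Cmod (truncation eps z).
Proof.
  intros He. apply Rle_trans with (2 := Rmax_Cmod _).
  apply Rle_trans with (2 := Rmax_r _ _). simpl.
  rewrite Rabs_pos_eq; pose proof (Rmax_r (snd z) eps); lra.
Qed.

Lemma truncation_neq_0 eps z : 0 < eps -> truncation eps z <> RtoC 0.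
Proof.
  intros He. apply Cmod_gt_0. pose proof (Cmod_truncation eps z He). lra.
Qed.

Lemma truncation_Lipschitz eps z w :
  Cmod (truncation eps z - truncation eps w) <= Cmod (z - w).
Proof.
  unfold Cmod. apply sqrt_le_1_alt. simpl.
  apply Rplus_le_compat_l. rewrite !Rmult_1_r. apply Rsqr_le_abs_1.
  unfold Rmax, Rabs. repeat destruct Rle_dec; repeat destruct Rcase_abs; lra.
Qed.

Lemma truncated_field_bounded v L eps t z :
  (forall t, Rabs (v t) <= L) -> 0 < eps ->
  Cmod (truncated_field v eps t z) <= 2 / eps + L.
Proof.
  intros Hv He. unfold truncated_field, Cminus.
  apply Rle_trans with (1 := Cmod_triangle _ _).
  rewrite Cmod_opp, Cmod_R, Cmod_div, Cmod_R, Rabs_left by (auto using truncation_neq_0; lra).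
  apply Rplus_le_compat; [| apply Hv].
  replace (- -2) with 2 by lra. apply Rmult_le_compat_l; [lra |].
  apply Rinv_le_contravar; auto using Cmod_truncation.
Qed.

Lemma truncated_field_Lipschitz v eps t z w :
  0 < eps ->
  Cmod (truncated_field v eps t z - truncated_field v eps t w)
    <= 2 / eps ^ 2 * Cmod (z - w).
Proof.
  intros He.
  pose proof (truncation_neq_0 eps z He) as Hz. pose proof (truncation_neq_0 eps w He) as Hw.
  pose proof (Cmod_truncation eps z He) as Bz. pose proof (Cmod_truncation eps w He) as Bw.
  replace (truncated_field v eps t z - truncated_field v eps t w)%C
    with (RtoC 2 * (truncation eps z - truncation eps w)
            / (truncation eps z * truncation eps w))%C
    by (unfold truncated_field; field; auto).
  rewrite Cmod_div by now apply Cmult_neq_0.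
  rewrite !Cmod_mult, Cmod_R, Rabs_pos_eq by lra.
  unfold Rdiv. rewrite !Rmult_assoc. apply Rmult_le_compat_l; [lra |].
  rewrite Rmult_comm. apply Rmult_le_compat; auto using Cmod_ge_0, truncation_Lipschitz.
  - left. apply Rinv_0_lt_compat. apply Rmult_lt_0_compat; lra.
  - apply Rinv_le_contravar; [nra |]. simpl. rewrite Rmult_1_r.
    apply Rmult_le_compat; lra.
Qed.

Lemma truncated_field_fst v eps t z :
  0 < eps -> fst (truncated_field v eps t z)
    = - 2 * fst z / (fst z ^ 2 + Rmax (snd z) eps ^ 2) - v t.
Proof.
  intros He. pose proof (Rmax_r (snd z) eps).
  unfold truncated_field, truncation. simpl. field. nra.
Qed.

Lemma truncated_field_snd v eps t z :
  0 < eps -> snd (truncated_field v eps t z)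
    = 2 * Rmax (snd z) eps / (fst z ^ 2 + Rmax (snd z) eps ^ 2).
Proof.
  intros He. pose proof (Rmax_r (snd z) eps).
  unfold truncated_field, truncation. simpl. field. nra.
Qed.

Lemma truncated_field_continuous v eps (u : R -> C) t :
  0 < eps -> (forall t, continuous v t) ->
  (forall t, continuous (U := C_R_NormedModule) u t) ->
  continuous (U := C_R_NormedModule) (fun s => truncated_field v eps s (u s)) t.
Proof.
  intros He Hv Hu.
  assert (H1 : continuous (fun s => fst (u s)) t).
  { apply (continuous_comp u (fun z : C => fst z) t (Hu t)). destruct (u t). apply continuous_fst. }
  assert (H2 : continuous (fun s => Rmax (snd (u s)) eps) t).
  { apply (continuous_comp (fun s => snd (u s)) (fun y => Rmax y eps)).
    - apply (continuous_comp u (fun z : C => snd z) t (Hu t)). destruct (u t). apply continuous_snd.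
    - apply continuous_Rmax_l. }
  assert (H3 : continuous (fun s => / (fst (u s) * fst (u s)
                 + Rmax (snd (u s)) eps * Rmax (snd (u s)) eps)) t).
  { apply continuous_Rinv_comp.
    - apply (continuous_plus (V := R_NormedModule));
        apply (continuous_mult (K := R_AbsRing)); assumption.
    - pose proof (Rmax_r (snd (u t)) eps). nra. }
  apply (continuous_ext (fun s =>
    (- 2 * (fst (u s) * / (fst (u s) * fst (u s) + Rmax (snd (u s)) eps * Rmax (snd (u s)) eps)) - v s,
     2 * (Rmax (snd (u s)) eps * / (fst (u s) * fst (u s) + Rmax (snd (u s)) eps * Rmax (snd (u s)) eps))))).
  { intros s. rewrite (surjective_pairing (truncated_field _ _ _ _)).
    rewrite truncated_field_fst, truncated_field_snd by assumption.
    pose proof (Rmax_r (snd (u s)) eps). f_equal; field; nra. }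
  apply continuous_pair.
  - apply (continuous_minus (V := R_NormedModule)); [| apply Hv].
    apply (continuous_scal_r (V := R_NormedModule) (-2)).
    now apply (continuous_mult (K := R_AbsRing)).
  - apply (continuous_scal_r (V := R_NormedModule) 2).
    now apply (continuous_mult (K := R_AbsRing)).
Qed.

Lemma truncated_flow v L eps t0 x0 y0 :
  0 < eps -> (forall t, continuous v t) -> (forall t, Rabs (v t) <= L) ->
  exists X Y : R -> R, X t0 = x0 /\ Y t0 = y0 /\ forall t,
    is_derive X t (- 2 * X t / (X t ^ 2 + Rmax (Y t) eps ^ 2) - v t) /\
    is_derive Y t (2 * Rmax (Y t) eps / (X t ^ 2 + Rmax (Y t) eps ^ 2)).
Proof.
  intros He Hc Hb.
  destruct (picard_lindelof (V := C_R_CompleteNormedModule) (truncated_field v eps)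
              (2 / eps ^ 2) (2 / eps + L) t0 (x0, y0)) as [u [Hu0 Hu]].
  - apply Rdiv_lt_0_compat; [lra | now apply pow_lt].
  - intros u Hu t. now apply truncated_field_continuous.
  - intros t z w. pose proof (truncated_field_Lipschitz v eps t z w He) as H.
    rewrite <- !norm_C_R in H. exact H.
  - intros t z. pose proof (truncated_field_bounded v L eps t z Hb He) as H.
    rewrite <- norm_C_R in H. exact H.
  - exists (fun t => fst (u t)), (fun t => snd (u t)).
    rewrite Hu0. split; [reflexivity |]. split; [reflexivity |].
    intros t. rewrite <- truncated_field_fst, <- (truncated_field_snd v eps t) by assumption.
    split; [now apply is_derive_fst | now apply is_derive_snd].
Qed.

(** Along the truncated flow the imaginary part increases, so that it stays
    above [eps] from the first time at which it is. *)
Lemma truncated_flow_trajectory v eps a b X Y :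
  0 < eps -> eps <= Y a ->
  (forall t,
    is_derive X t (- 2 * X t / (X t ^ 2 + Rmax (Y t) eps ^ 2) - v t) /\
    is_derive Y t (2 * Rmax (Y t) eps / (X t ^ 2 + Rmax (Y t) eps ^ 2))) ->
  trajectory v a b X Y.
Proof.
  intros He Ha H t Ht.
  assert (Hpos : forall s, 0 <= 2 * Rmax (Y s) eps / (X s ^ 2 + Rmax (Y s) eps ^ 2)).
  { intros s. pose proof (Rmax_r (Y s) eps). apply Rdiv_le_0_compat; nra. }
  assert (HY : eps <= Y t).
  { apply Rle_trans with (1 := Ha).
    apply (nondecreasing_of_derive Y _ a t (proj1 Ht) (fun s _ => proj2 (H s))).
    intros; apply Hpos. }
  destruct (H t) as [HX HY']. rewrite Rmax_left in HX, HY' by assumption.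
  split; [lra | now split].
Qed.

(** * Distances between trajectories *)

Definition dist2 (X1 Y1 X2 Y2 : R -> R) (t : R) : R :=
  (X1 t - X2 t) ^ 2 + (Y1 t - Y2 t) ^ 2.

Lemma dist2_nonneg X1 Y1 X2 Y2 t : 0 <= dist2 X1 Y1 X2 Y2 t.
Proof. unfold dist2. apply Rplus_le_le_0_compat; apply pow2_ge_0. Qed.

(** The difference [D] of two solutions satisfies [D' = 2 D / (Z1 Z2)], whence
    the derivative of the square of its modulus. *)
Lemma dist2_derive v X1 Y1 X2 Y2 t :
  flows_at v X1 Y1 t -> flows_at v X2 Y2 t ->
  is_derive (dist2 X1 Y1 X2 Y2) t
    (4 * dist2 X1 Y1 X2 Y2 t * ((X1 t * X2 t - Y1 t * Y2 t)
       / ((X1 t ^ 2 + Y1 t ^ 2) * (X2 t ^ 2 + Y2 t ^ 2)))).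
Proof.
  intros (P1 & HX1 & HY1) (P2 & HX2 & HY2). unfold dist2. auto_derive.
  - repeat split; eexists; eassumption.
  - rewrite (is_derive_unique (fun x : R => X1 x) t _ HX1), (is_derive_unique (fun x : R => X2 x) t _ HX2),
      (is_derive_unique (fun x : R => Y1 x) t _ HY1), (is_derive_unique (fun x : R => Y2 x) t _ HY2).
    assert (0 < X1 t ^ 2 + Y1 t ^ 2) by nra. assert (0 < X2 t ^ 2 + Y2 t ^ 2) by nra.
    simpl in *. field. lra.
Qed.

Lemma trajectory_Y_le v a b X Y s t :
  trajectory v a b X Y -> a <= s -> s <= t -> t <= b -> Y s <= Y t.
Proof.
  intros H Ha Hst Hb.
  apply (nondecreasing_of_derive Y (fun t => 2 * Y t / (X t ^ 2 + Y t ^ 2))); auto.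
  - intros r Hr. apply (H r). lra.
  - intros r Hr. destruct (H r) as [P _]; [lra |]. apply Rdiv_le_0_compat; nra.
Qed.

Lemma is_derive_sqr (f : R -> R) (t l : R) :
  is_derive f t l -> is_derive (fun s => f s ^ 2) t (2 * f t * l).
Proof.
  intros H. auto_derive; [now exists l |].
  rewrite (is_derive_unique (fun x : R => f x) t _ H). ring.
Qed.

Lemma flows_at_sqr_derive v X Y t :
  flows_at v X Y t ->
  is_derive (fun s => Y s ^ 2) t (4 * (Y t ^ 2 / (X t ^ 2 + Y t ^ 2))).
Proof.
  intros (P & _ & H). replace (4 * _) with (2 * Y t * (2 * Y t / (X t ^ 2 + Y t ^ 2))).
  - now apply is_derive_sqr.
  - field. nra.
Qed.

Lemma trajectory_Ysqr_le v a b X Y s t :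
  trajectory v a b X Y -> a <= s -> s <= t -> t <= b ->
  Y t ^ 2 <= Y s ^ 2 + 4 * (t - s).
Proof.
  intros H Ha Hst Hb.
  enough (E : 4 * s - Y s ^ 2 <= 4 * t - Y t ^ 2) by lra.
  apply (nondecreasing_of_derive (fun r => 4 * r - Y r ^ 2)
           (fun r => 4 - 4 * (Y r ^ 2 / (X r ^ 2 + Y r ^ 2))) s t); auto.
  - intros r Hr. apply (is_derive_minus (V := R_NormedModule) (fun r => 4 * r)).
    + auto_derive; trivial. ring.
    + apply (flows_at_sqr_derive v), H. lra.
  - intros r Hr. destruct (H r) as [P _]; [lra |].
    assert (Y r ^ 2 / (X r ^ 2 + Y r ^ 2) <= 1); [| lra].
    apply Rle_div_l; nra.
Qed.

Lemma Rle_div_nonneg (a b c : R) : 0 < b -> a <= c * b -> a / b <= c.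
Proof. intros Hb H. now apply Rle_div_l. Qed.

(** The quotient is the real part of [1 / (z1 z2)]. *)
Lemma inverse_product_bound x1 y1 x2 y2 c :
  0 < c -> c <= y1 * y2 -> 0 < y1 -> 0 < y2 ->
  Rabs ((x1 * x2 - y1 * y2) / ((x1 ^ 2 + y1 ^ 2) * (x2 ^ 2 + y2 ^ 2))) <= / c.
Proof.
  intros Hc Hle H1 H2.
  assert (HN : 0 < (x1 ^ 2 + y1 ^ 2) * (x2 ^ 2 + y2 ^ 2)) by (apply Rmult_lt_0_compat; nra).
  assert (Hp : Rabs (x1 * x2 - y1 * y2) * (y1 * y2)
               <= (x1 ^ 2 + y1 ^ 2) * (x2 ^ 2 + y2 ^ 2)).
  { assert (0 < y1 * y2) by nra.
    pose proof (pow2_ge_0 (x1 * y2 - x2 * y1)). pose proof (pow2_ge_0 (x1 * y2 + x2 * y1)).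
    pose proof (pow2_ge_0 (x1 * x2)). pose proof (pow2_ge_0 (y1 * y2)).
    unfold Rabs; destruct Rcase_abs; nra. }
  unfold Rdiv. rewrite Rabs_mult, (Rabs_pos_eq (/ _)) by (left; now apply Rinv_0_lt_compat).
  apply Rle_div_nonneg; [assumption |].
  apply Rmult_le_reg_l with c; [assumption |].
  rewrite <- Rmult_assoc, Rinv_r, Rmult_1_l by lra.
  apply Rle_trans with (2 := Hp). rewrite Rmult_comm.
  apply Rmult_le_compat_l; [apply Rabs_pos | assumption].
Qed.

Section Two_trajectories.

Variables (v : R -> R) (a b c : R) (X1 Y1 X2 Y2 : R -> R).
Hypothesis c_pos : 0 < c.
Hypothesis traj1 : trajectory v a b X1 Y1.
Hypothesis traj2 : trajectory v a b X2 Y2.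
Hypothesis above1 : c <= Y1 a.
Hypothesis above2 : c <= Y2 a.

Lemma dist2_rate_bound t : a <= t <= b ->
  Rabs ((X1 t * X2 t - Y1 t * Y2 t)
       / ((X1 t ^ 2 + Y1 t ^ 2) * (X2 t ^ 2 + Y2 t ^ 2))) <= / c ^ 2.
Proof.
  intros Ht.
  pose proof (trajectory_Y_le _ _ _ _ _ a t traj1 ltac:(lra) ltac:(lra) ltac:(lra)).
  pose proof (trajectory_Y_le _ _ _ _ _ a t traj2 ltac:(lra) ltac:(lra) ltac:(lra)).
  apply inverse_product_bound; nra.
Qed.

Lemma dist2_forward : a <= b ->
  dist2 X1 Y1 X2 Y2 b <= exp (4 / c ^ 2 * (b - a)) * dist2 X1 Y1 X2 Y2 a.
Proof.
  intros Hab. eapply gronwall_forward; auto.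
  - intros t Ht. apply (dist2_derive v); auto.
  - intros t Ht. simpl. pose proof (dist2_rate_bound t Ht) as Hr.
    pose proof (dist2_nonneg X1 Y1 X2 Y2 t).
    apply Rle_trans with (4 * dist2 X1 Y1 X2 Y2 t * / c ^ 2); [| right; field; lra].
    apply Rmult_le_compat_l; [lra |]. apply Rle_trans with (2 := Hr), Rle_abs.
Qed.

Lemma dist2_backward : a <= b ->
  dist2 X1 Y1 X2 Y2 a <= exp (4 / c ^ 2 * (b - a)) * dist2 X1 Y1 X2 Y2 b.
Proof.
  intros Hab. eapply gronwall_backward; auto.
  - intros t Ht. apply (dist2_derive v); auto.
  - intros t Ht. simpl. pose proof (dist2_rate_bound t Ht) as Hr.
    pose proof (dist2_nonneg X1 Y1 X2 Y2 t).
    apply Rle_trans with (4 * dist2 X1 Y1 X2 Y2 t * - / c ^ 2); [right; field; lra |].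
    apply Rmult_le_compat_l; [lra |]. apply Rabs_le_between in Hr. apply Hr.
Qed.

End Two_trajectories.

Lemma dist2_le_0 X1 Y1 X2 Y2 t :
  dist2 X1 Y1 X2 Y2 t <= 0 -> X1 t = X2 t /\ Y1 t = Y2 t.
Proof.
  unfold dist2. intros H.
  pose proof (pow2_ge_0 (X1 t - X2 t)). pose proof (pow2_ge_0 (Y1 t - Y2 t)).
  split; apply Rminus_diag_uniq; apply Rsqr_0_uniq; unfold Rsqr; lra.
Qed.

Lemma dist2_eq X1 Y1 X2 Y2 t :
  X1 t = X2 t -> Y1 t = Y2 t -> dist2 X1 Y1 X2 Y2 t = 0.
Proof. unfold dist2. intros -> ->. ring. Qed.

Lemma trajectory_backward_unique v a b X1 Y1 X2 Y2 :
  a <= b -> trajectory v a b X1 Y1 -> trajectory v a b X2 Y2 ->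
  X1 b = X2 b -> Y1 b = Y2 b -> X1 a = X2 a /\ Y1 a = Y2 a.
Proof.
  intros Hab H1 H2 EX EY. apply dist2_le_0.
  destruct (H1 a) as [P1 _]; [lra |]. destruct (H2 a) as [P2 _]; [lra |].
  pose proof (dist2_backward v a b (Rmin (Y1 a) (Y2 a)) X1 Y1 X2 Y2
    ltac:(now apply Rmin_glb_lt) H1 H2 (Rmin_l _ _) (Rmin_r _ _) Hab) as H.
  rewrite (dist2_eq X1 Y1 X2 Y2 b EX EY), Rmult_0_r in H. exact H.
Qed.

Lemma trajectory_forward_unique v a b X1 Y1 X2 Y2 :
  a <= b -> trajectory v a b X1 Y1 -> trajectory v a b X2 Y2 ->
  X1 a = X2 a -> Y1 a = Y2 a -> X1 b = X2 b /\ Y1 b = Y2 b.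
Proof.
  intros Hab H1 H2 EX EY. apply dist2_le_0.
  destruct (H1 a) as [P1 _]; [lra |]. destruct (H2 a) as [P2 _]; [lra |].
  pose proof (dist2_forward v a b (Rmin (Y1 a) (Y2 a)) X1 Y1 X2 Y2
    ltac:(now apply Rmin_glb_lt) H1 H2 (Rmin_l _ _) (Rmin_r _ _) Hab) as H.
  rewrite (dist2_eq X1 Y1 X2 Y2 a EX EY), Rmult_0_r in H. exact H.
Qed.

(** * Trajectories emerging from the driver *)

(** As [Y] increases, the second clause says that [Y] tends to [0] at time [s].
    That [X] does so too, so that the solution starts from the driver, is a
    consequence ([half_cone_of_emerges]). *)
Definition emerges (v : R -> R) (s T : R) (X Y : R -> R) : Prop :=
  (forall t, s < t <= T -> flows_at v X Y t) /\
  (forall eps, 0 < eps -> exists t, s < t <= T /\ Y t < eps).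

Lemma emerges_trajectory v s T X Y a :
  emerges v s T X Y -> s < a -> trajectory v a T X Y.
Proof. intros [H _] Ha t Ht. apply H. lra. Qed.

(** Running the truncated flows backward from time [T], let [tau eps] be the
    time at which the height [eps] is reached. The flows agree above the larger
    height, so that they glue to a solution that exists until
    [s = inf tau eps]. *)
Lemma backward_dichotomy v L T x y :
  0 < T -> 0 < y -> (forall t, continuous v t) -> (forall t, Rabs (v t) <= L) ->
  exists X Y : R -> R, X T = x /\ Y T = y /\
    (trajectory v 0 T X Y \/ exists s, 0 <= s < T /\ emerges v s T X Y).
Proof.
  intros HT Hy Hc Hb.
  assert (Hex : forall eps, exists U : (R -> R) * (R -> R), 0 < eps ->
    fst U T = x /\ snd U T = y /\ forall t,
    is_derive (fst U) t (- 2 * fst U t / (fst U t ^ 2 + Rmax (snd U t) eps ^ 2) - v t) /\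
    is_derive (snd U) t (2 * Rmax (snd U t) eps / (fst U t ^ 2 + Rmax (snd U t) eps ^ 2))).
  { intros eps. destruct (Rlt_dec 0 eps) as [He | He].
    - destruct (truncated_flow v L eps T x y He Hc Hb) as (X & Y & H).
      now exists (X, Y).
    - exists (fun _ => 0, fun _ => 0). intros; contradiction. }
  destruct (choice _ Hex) as [U HU]. clear Hex.
  set (A := fun t => 0 <= t <= T /\ exists eps, 0 < eps /\ eps <= snd (U eps) t).
  assert (Htraj : forall eps a b, 0 < eps -> eps <= snd (U eps) a ->
            trajectory v a b (fst (U eps)) (snd (U eps))).
  { intros eps a b He Ha. destruct (HU eps He) as (_ & _ & H).
    now apply (truncated_flow_trajectory v eps). }
  assert (Hagree : forall e1 e2 t, 0 < e1 -> 0 < e2 ->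
            e1 <= snd (U e1) (Rmin t T) -> e2 <= snd (U e2) (Rmin t T) ->
            fst (U e1) t = fst (U e2) t /\ snd (U e1) t = snd (U e2) t).
  { intros e1 e2 t He1 He2 H1 H2.
    destruct (HU e1 He1) as (EX1 & EY1 & _). destruct (HU e2 He2) as (EX2 & EY2 & _).
    destruct (Rle_dec t T) as [Ht | Ht].
    - rewrite Rmin_left in H1, H2 by assumption.
      apply (trajectory_backward_unique v t T); auto; congruence.
    - rewrite Rmin_right in H1, H2 by lra.
      apply (trajectory_forward_unique v T t); auto; try lra; congruence. }
  destruct (classic (A 0)) as [[_ (eps & He & H0)] | H0].
  { destruct (HU eps He) as (EX & EY & _).
    exists (fst (U eps)), (snd (U eps)). auto. }
  assert (Hup : forall t t', A t -> t <= t' <= T -> A t').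
  { intros t t' [Ht (eps & He & H)] Ht'. split; [lra |].
    exists eps. split; [assumption |]. apply Rle_trans with (1 := H).
    apply (trajectory_Y_le v t T (fst (U eps)) (snd (U eps))); auto; lra. }
  assert (Htau : forall eps, 0 < eps <= y -> exists t, A t /\ snd (U eps) t = eps).
  { intros eps He. destruct (HU eps (proj1 He)) as (_ & EY & HdU).
    assert (snd (U eps) 0 < eps).
    { apply Rnot_le_lt. intros H. apply H0. split; [lra |]. now exists eps. }
    destruct (IVT_gen (snd (U eps)) 0 T eps) as [t [Ht Et]].
    - intros t. apply continuity_pt_filterlim.
      eapply is_derive_continuous, (proj2 (HdU t)).
    - rewrite EY, Rmin_left, Rmax_right; lra.
    - rewrite Rmin_left, Rmax_right in Ht by lra.
      exists t. split; [| assumption]. split; [assumption |]. exists eps. lra. }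
  destruct (completeness (fun r => A (- r))) as [r [Hub Hlub]].
  { exists 0. intros r [Hr _]. lra. }
  { destruct (Htau y) as [t [Ht _]]; [lra |]. exists (- t). now rewrite Ropp_involutive. }
  set (s := - r).
  assert (Hlow : forall t, A t -> s <= t).
  { intros t Ht. enough (- t <= r) by (unfold s; lra). apply Hub. now rewrite Ropp_involutive. }
  assert (Happ : forall t, s < t -> exists t', A t' /\ t' < t).
  { intros t Ht. apply NNPP. intros Hn.
    assert (r <= - t); [| unfold s in Ht; lra].
    apply Hlub. intros q Hq. apply Rnot_lt_le. intros Hlt.
    apply Hn. exists (- q). split; [assumption | lra]. }
  assert (HA : forall t, s < t <= T -> A t).
  { intros t Ht. destruct (Happ t (proj1 Ht)) as (t' & Ht' & Hlt).
    apply (Hup t'); [assumption | lra]. }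
  assert (Hs0 : 0 <= s).
  { unfold s. enough (r <= 0) by lra. apply Hlub. intros q [Hq _]. lra. }
  (* The height increases strictly, so that no [tau eps] is the infimum. *)
  assert (Hlev : forall eps, 0 < eps <= y -> exists t, s < t <= T /\ snd (U eps) t = eps).
  { intros eps He. destruct (Htau eps He) as (t & Ht & Et). exists t.
    split; [| assumption]. split; [| apply Ht].
    destruct (Rle_lt_or_eq_dec s t (Hlow t Ht)) as [| Est]; [assumption | exfalso].
    destruct (Htau (eps / 2)) as (t' & Ht' & Et'); [lra |].
    pose proof (Hlow t' Ht') as Hst'.
    assert (Hm : Rmin t' T = t') by (apply Rmin_left, Ht').
    destruct (Hagree eps (eps / 2) t') as [_ E]; rewrite ?Hm; try lra.
    - rewrite <- Et at 1.
      apply (trajectory_Y_le v t T (fst (U eps)) (snd (U eps))); try lra.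
      + apply Htraj; lra.
      + apply Ht'.
    - rewrite Et' in E.
      assert (snd (U eps) t <= snd (U eps) t'); [| lra].
      apply (trajectory_Y_le v t T (fst (U eps)) (snd (U eps))); try lra.
      + apply Htraj; lra.
      + apply Ht'. }
  assert (HsT : s < T) by (destruct (Hlev y) as [t Ht]; lra).
  assert (Hch : forall t, exists eps, s < t <= T -> 0 < eps /\ eps <= snd (U eps) t).
  { intros t. destruct (classic (s < t <= T)) as [Ht | Ht].
    - destruct (HA t Ht) as [_ [eps He]]. now exists eps.
    - exists 0. intros; contradiction. }
  destruct (choice _ Hch) as [e He].
  set (X := fun t => fst (U (e (Rmin t T))) t).
  set (Y := fun t => snd (U (e (Rmin t T))) t).
  assert (Hglue : forall eps a t, s < a <= T -> 0 < eps -> eps <= snd (U eps) a -> a <= t ->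
            X t = fst (U eps) t /\ Y t = snd (U eps) t).
  { intros eps a t Ha Heps H Hat.
    assert (a <= Rmin t T) by (apply Rmin_glb; lra). pose proof (Rmin_r t T).
    destruct (He (Rmin t T)) as [He1 He2]; [lra |].
    apply Hagree; auto.
    apply Rle_trans with (1 := H).
    apply (trajectory_Y_le v a T (fst (U eps)) (snd (U eps))); auto; lra. }
  exists X, Y.
  assert (HeT := He T ltac:(lra)).
  unfold X at 1, Y at 1. rewrite (Rmin_left T T) by lra.
  destruct (HU (e T) (proj1 HeT)) as (EX & EY & _).
  split; [exact EX |]. split; [exact EY |].
  right. exists s. split; [lra |]. split.
  - intros t Ht.
    set (a := (s + t) / 2). assert (Ha : s < a <= T) by (unfold a; lra).
    assert (Hat : a < t) by (unfold a; lra).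
    destruct (He a Ha) as [He1 He2].
    assert (Hloc : locally t (fun q => a <= q)).
    { assert (Hd : 0 < t - a) by lra. exists (mkposreal _ Hd). intros q Hq.
      change (Rabs (q - t) < t - a) in Hq. apply Rabs_def2 in Hq. lra. }
    destruct (Htraj (e a) a T He1 He2 t ltac:(lra)) as (HP & HdX & HdY).
    destruct (Hglue (e a) a t Ha He1 He2 ltac:(lra)) as [EXt EYt].
    rewrite <- EXt, <- EYt in HdX, HdY. rewrite <- EYt in HP.
    split; [assumption |]. split.
    + apply (is_derive_ext_loc (fst (U (e a)))); [| assumption].
      apply (filter_imp (fun q => a <= q)); [| assumption].
      intros q Hq. symmetry. now apply (Hglue (e a) a q).
    + apply (is_derive_ext_loc (snd (U (e a)))); [| assumption].
      apply (filter_imp (fun q => a <= q)); [| assumption].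
      intros q Hq. symmetry. now apply (Hglue (e a) a q).
  - intros eps Heps.
    destruct (Hlev (Rmin (eps / 2) y)) as (t & Ht & Et).
    { split; [apply Rmin_glb_lt; lra | apply Rmin_r]. }
    exists t. split; [assumption |].
    pose proof (Rmin_l (eps / 2) y).
    assert (0 < Rmin (eps / 2) y) by (apply Rmin_glb_lt; lra).
    destruct (Hglue (Rmin (eps / 2) y) t t Ht) as [_ ->]; lra.
Qed.

Lemma flows_at_reflect v X Y t :
  flows_at v X Y t -> flows_at (fun s => - v s) (fun s => - X s) Y t.
Proof.
  intros (P & HX & HY). split; [assumption |].
  replace ((- X t) ^ 2) with (X t ^ 2) by ring. split; [| assumption].
  replace (- 2 * - X t / _ - - v t) with (- (- 2 * X t / (X t ^ 2 + Y t ^ 2) - v t))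
    by (field; nra).
  apply (is_derive_opp (V := R_NormedModule) X), HX.
Qed.

Lemma slope_bound rho w : 0 < rho -> Rabs w * rho <= 1 -> - / rho <= w <= / rho.
Proof.
  intros Hr Hw. apply Rabs_le_between.
  apply Rmult_le_reg_r with rho; [assumption |]. now rewrite Rinv_l by lra.
Qed.

(** On the ray [X = Y] below height [rho] the difference [X - Y] decreases at
    rate at least [2 / Y - 1 / rho]: the cone [X <= Y] cannot be left there. *)
Lemma half_cone_invariant v rho a b X Y :
  0 < rho -> (forall t, Rabs (v t) * rho <= 1) -> a <= b ->
  trajectory v a b X Y -> Y b <= rho -> X a <= Y a -> X b <= Y b.
Proof.
  intros Hr Hv Hab H Hb Ha.
  enough (X b - Y b <= 0) by lra.
  apply (barrier_forward (fun t => X t - Y t) (fun t =>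
    (- 2 * X t / (X t ^ 2 + Y t ^ 2) - v t) - 2 * Y t / (X t ^ 2 + Y t ^ 2)) a b Hab).
  - intros t Ht. destruct (H t Ht) as (_ & HX & HY).
    now apply (is_derive_minus (V := R_NormedModule)).
  - intros t Ht E. destruct (H t Ht) as (P & _).
    pose proof (trajectory_Y_le v a b X Y t b H ltac:(lra) ltac:(lra) ltac:(lra)).
    pose proof (slope_bound rho (v t) Hr (Hv t)).
    replace (X t) with (Y t) by lra.
    replace (- 2 * Y t / (Y t ^ 2 + Y t ^ 2) - v t - 2 * Y t / (Y t ^ 2 + Y t ^ 2))
      with (- 2 * / Y t - v t) by (field; nra).
    assert (/ rho <= / Y t) by (apply Rinv_le_contravar; lra).
    assert (0 < / rho) by (now apply Rinv_0_lt_compat). lra.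
  - lra.
Qed.

(** Outside of the cone [X <= Y] the real part would stay away from [0], going
    backward in time, and then [Y' / Y] would be too small for [Y] to come from
    [0]. *)
Lemma half_cone_of_emerges v rho s T X Y t :
  0 < rho -> (forall t, Rabs (v t) * rho <= 1) ->
  emerges v s T X Y -> s < t <= T -> Y t <= rho -> X t <= Y t.
Proof.
  intros Hr Hv Hem Ht Hy.
  apply Rnot_lt_le. intros Hn.
  destruct (proj1 Hem t Ht) as [Pt _].
  assert (Htr : forall r, s < r -> trajectory v r t X Y).
  { intros r Hsr. apply (trajectory_sub v r T); try lra. now apply (emerges_trajectory v s). }
  assert (Hout : forall r, s < r <= t -> Y r < X r).
  { intros r Hsr. apply Rnot_le_lt. intros Hle.
    pose proof (half_cone_invariant v rho r t X Y Hr Hv (proj2 Hsr)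
                  (Htr r (proj1 Hsr)) Hy Hle). lra. }
  set (m := Rmin (X t) (rho / 2)).
  assert (Hm : 0 < m) by (apply Rmin_glb_lt; lra).
  assert (Hmt : m <= X t) by apply Rmin_l. assert (Hmr : m <= rho / 2) by apply Rmin_r.
  assert (Hfar : forall r, s < r <= t -> m <= X r).
  { intros r Hsr. enough (m - X r <= 0) by lra.
    apply (barrier_backward (fun q => m - X q) (fun q =>
      - (- 2 * X q / (X q ^ 2 + Y q ^ 2) - v q)) r t (proj2 Hsr)).
    - intros q Hq. destruct (Htr r (proj1 Hsr) q Hq) as (_ & HX & _).
      replace (- (_ - _)) with (minus (G := R_AbelianGroup) 0 (- 2 * X q / (X q ^ 2 + Y q ^ 2) - v q))
        by (unfold minus, plus, opp; simpl; ring).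
      apply (is_derive_minus (V := R_NormedModule) (fun _ => m) X); [| assumption].
      apply (is_derive_const (V := R_NormedModule)).
    - intros q Hq E. destruct (Htr r (proj1 Hsr) q Hq) as (P & _).
      pose proof (slope_bound rho (v q) Hr (Hv q)).
      pose proof (Hout q ltac:(lra)).
      replace (X q) with m in * by lra.
      assert (/ m <= 2 * m / (m ^ 2 + Y q ^ 2)).
      { apply Rle_div_r; [nra |]. apply Rmult_le_reg_l with m; [assumption |].
        rewrite <- Rmult_assoc, Rinv_r by lra. nra. }
      assert (/ rho < / m) by (apply Rinv_lt_contravar; nra).
      replace (- 2 * m / (m ^ 2 + Y q ^ 2)) with (- (2 * m / (m ^ 2 + Y q ^ 2)))
        by (field; nra). lra.
    - lra. }
  set (E := exp (2 / m ^ 2 * (t - s))).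
  assert (HE : 1 <= E).
  { unfold E. rewrite <- exp_0. apply exp_monotone.
    apply Rmult_le_pos; [| lra]. apply Rdiv_le_0_compat; nra. }
  destruct (proj2 Hem (Y t / E)) as (r & Hsr & Hrlow).
  { apply Rdiv_lt_0_compat; lra. }
  assert (HYr : E * Y r < Y t).
  { apply Rmult_lt_reg_l with (/ E); [apply Rinv_0_lt_compat; lra |].
    rewrite <- Rmult_assoc, Rinv_l, Rmult_1_l by lra. unfold Rdiv in Hrlow. lra. }
  destruct (proj1 Hem r Hsr) as [Pr _].
  assert (Hrt : r < t).
  { apply Rnot_le_lt. intros Hle.
    pose proof (trajectory_Y_le v t T X Y t r
      (emerges_trajectory v s T X Y t Hem (proj1 Ht)) ltac:(lra) Hle (proj2 Hsr)). nra. }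
  assert (Hg : Y t <= exp (2 / m ^ 2 * (t - r)) * Y r).
  { apply (gronwall_forward Y (fun q => 2 * Y q / (X q ^ 2 + Y q ^ 2))); [lra | |].
    - intros q Hq. apply (Htr r (proj1 Hsr) q Hq).
    - intros q Hq. destruct (Htr r (proj1 Hsr) q Hq) as (P & _).
      pose proof (Hfar q ltac:(lra)).
      apply Rle_div_nonneg; [nra |].
      apply Rmult_le_reg_l with (m ^ 2); [nra |].
      replace (m ^ 2 * (2 / m ^ 2 * Y q * (X q ^ 2 + Y q ^ 2)))
        with (2 * Y q * (X q ^ 2 + Y q ^ 2)) by (field; lra).
      rewrite Rmult_comm. apply Rmult_le_compat_l; nra. }
  assert (exp (2 / m ^ 2 * (t - r)) <= E).
  { unfold E. apply exp_monotone. apply Rmult_le_compat_l; [| lra].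
    apply Rdiv_le_0_compat; nra. }
  nra.
Qed.

(** The estimates shared by the solutions that emerge from the driver at time
    [s] and by those that start at [i y] over the driver at that time, with
    [e = y ^ 2]: below height [rho] they stay within 45 degrees of the vertical
    and rise at least like [sqrt (2 (t - s))]. *)
Definition fan (v : R -> R) (rho s e T : R) (X Y : R -> R) : Prop :=
  forall t, s < t <= T ->
    flows_at v X Y t /\
    (Y t <= rho -> Rabs (X t) <= Y t /\ 2 * (t - s) <= Y t ^ 2) /\
    Y t ^ 2 <= 4 * (t - s) + e.

Lemma fan_trajectory v rho s e T X Y a :
  fan v rho s e T X Y -> s < a -> trajectory v a T X Y.
Proof. intros H Ha t Ht. apply H. lra. Qed.

Lemma fan_of_cone v rho s e T X Y :
  (forall t, s < t <= T -> flows_at v X Y t) ->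
  (forall t, s < t <= T -> Y t <= rho -> Rabs (X t) <= Y t) ->
  (forall t, s < t <= T -> Y t ^ 2 <= 4 * (t - s) + e) ->
  fan v rho s e T X Y.
Proof.
  intros Hfl Hcone Hup t Ht.
  split; [now apply Hfl |]. split; [| now apply Hup].
  intros Hy. split; [now apply Hcone |].
  assert (H : forall r, s < r <= t -> 2 * (t - r) <= Y t ^ 2).
  { intros r Hr.
    assert (Htr : trajectory v r T X Y) by (intros q Hq; apply Hfl; lra).
    assert (M : Y r ^ 2 - 2 * r <= Y t ^ 2 - 2 * t).
    { apply (nondecreasing_of_derive (fun q => Y q ^ 2 - 2 * q)
        (fun q => 4 * (Y q ^ 2 / (X q ^ 2 + Y q ^ 2)) - 2) r t); [lra | |].
      - intros q Hq. apply (is_derive_minus (V := R_NormedModule) (fun q => Y q ^ 2)).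
        + apply (flows_at_sqr_derive v), Hfl. lra.
        + auto_derive; trivial. ring.
      - intros q Hq. destruct (Hfl q) as [P _]; [lra |].
        pose proof (trajectory_Y_le v r T X Y q t Htr ltac:(lra) ltac:(lra) ltac:(lra)).
        assert (Hc : Rabs (X q) <= Y q) by (apply Hcone; lra).
        apply Rabs_le_between in Hc.
        assert (1 / 2 <= Y q ^ 2 / (X q ^ 2 + Y q ^ 2)); [| lra].
        assert (X q ^ 2 <= Y q ^ 2) by nra.
        apply (Rle_div_r (1 / 2)); nra. }
    pose proof (pow2_ge_0 (Y r)). lra. }
  apply le_epsilon. intros eps He.
  assert (Hr : s < Rmin t (s + eps / 2)) by (apply Rmin_glb_lt; lra).
  pose proof (H _ (conj Hr (Rmin_l _ _))). pose proof (Rmin_r t (s + eps / 2)). lra.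
Qed.

Lemma fan_of_emerges v rho s T X Y :
  0 < rho -> (forall t, Rabs (v t) * rho <= 1) ->
  emerges v s T X Y -> fan v rho s 0 T X Y.
Proof.
  intros Hr Hv Hem. apply (fan_of_cone v); [apply Hem | |].
  - intros t Ht Hy. apply Rabs_le. split.
    + enough (- X t <= Y t) by lra.
      apply (half_cone_of_emerges (fun s => - v s) rho s T (fun s => - X s) Y t); auto.
      * intros q. now rewrite Rabs_Ropp.
      * destruct Hem as [H1 H2]. split; [| assumption].
        intros q Hq. now apply flows_at_reflect, H1.
    + now apply (half_cone_of_emerges v rho s T X Y t).
  - intros t Ht. rewrite Rplus_0_r. apply le_epsilon. intros eps He.
    destruct (proj1 Hem t Ht) as [Pt _].
    destruct (proj2 Hem (Rmin (Rmin 1 eps) (Y t))) as (r & Hsr & Hy).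
    { repeat apply Rmin_glb_lt; lra. }
    pose proof (Rmin_l (Rmin 1 eps) (Y t)). pose proof (Rmin_r (Rmin 1 eps) (Y t)).
    pose proof (Rmin_l 1 eps). pose proof (Rmin_r 1 eps).
    destruct (proj1 Hem r Hsr) as [Pr _].
    assert (r <= t).
    { apply Rnot_lt_le. intros Hlt.
      pose proof (trajectory_Y_le v t T X Y t r
        (emerges_trajectory v s T X Y t Hem (proj1 Ht)) ltac:(lra) ltac:(lra) (proj2 Hsr)). lra. }
    pose proof (trajectory_Ysqr_le v r T X Y r t
      (emerges_trajectory v s T X Y r Hem (proj1 Hsr)) ltac:(lra) ltac:(lra) (proj2 Ht)). nra.
Qed.

Lemma fan_of_vertical_start v rho s T X Y :
  0 < rho -> (forall t, Rabs (v t) * rho <= 1) ->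
  trajectory v s T X Y -> X s = 0 -> fan v rho s (Y s ^ 2) T X Y.
Proof.
  intros Hr Hv H H0. apply (fan_of_cone v).
  - intros t Ht. apply H. lra.
  - intros t Ht Hy. destruct (H s) as [P _]; [lra |]. apply Rabs_le. split.
    + enough (- X t <= Y t) by lra.
      apply (half_cone_invariant (fun s => - v s) rho s t (fun s => - X s) Y); auto; try lra.
      * intros q. now rewrite Rabs_Ropp.
      * intros q Hq. apply flows_at_reflect, H. lra.
    + apply (half_cone_invariant v rho s t X Y); auto; try lra.
      apply (trajectory_sub v s T); auto; lra.
  - intros t Ht. rewrite Rplus_comm.
    apply (trajectory_Ysqr_le v s T X Y s t H); lra.
Qed.

(** Within the fan the flow contracts: [1 / (Z1 Z2)] has negative real part
    when both arguments are within 45 degrees of the vertical. Once one of the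
    two solutions is above height [rho], both are above [rho / 2], and the flow
    expands at most exponentially. *)
Lemma fan_stability v rho s1 e1 s2 e2 T X1 Y1 X2 Y2 t :
  0 < rho -> fan v rho s1 e1 T X1 Y1 -> fan v rho s2 e2 T X2 Y2 ->
  s1 <= s2 <= s1 + rho ^ 2 / 16 -> 0 <= e1 <= rho ^ 2 / 4 -> 0 <= e2 <= rho ^ 2 / 4 ->
  s2 < t <= T ->
  dist2 X1 Y1 X2 Y2 t
    <= exp (8 / rho ^ 2 * (t - s2)) * (4 * (4 * (s2 - s1) + e1 + e2)).
Proof.
  intros Hr H1 H2 Hs He1 He2 Ht.
  assert (Hr2 : 0 < rho ^ 2) by nra.
  assert (Hrate : forall q, s2 < q <= T ->
    4 * dist2 X1 Y1 X2 Y2 q * ((X1 q * X2 q - Y1 q * Y2 q)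
       / ((X1 q ^ 2 + Y1 q ^ 2) * (X2 q ^ 2 + Y2 q ^ 2)))
    <= 8 / rho ^ 2 * dist2 X1 Y1 X2 Y2 q).
  { intros q Hq. pose proof (dist2_nonneg X1 Y1 X2 Y2 q) as Hd.
    destruct (H1 q ltac:(lra)) as ((P1 & _) & L1 & U1).
    destruct (H2 q ltac:(lra)) as ((P2 & _) & L2 & U2).
    replace (8 / rho ^ 2 * dist2 X1 Y1 X2 Y2 q)
      with (4 * dist2 X1 Y1 X2 Y2 q * / (rho ^ 2 / 2)) by (field; lra).
    apply Rmult_le_compat_l; [lra |].
    assert (Hinv : 0 < / (rho ^ 2 / 2)) by (apply Rinv_0_lt_compat; lra).
    assert (Hprod : rho < Y1 q \/ rho < Y2 q -> rho ^ 2 / 2 <= Y1 q * Y2 q).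
    { intros Hor.
      assert (Hq' : rho ^ 2 / 8 <= q - s2) by (destruct Hor; nra).
      assert (B1 : rho / 2 <= Y1 q).
      { destruct (Rle_dec (Y1 q) rho) as [Hle |]; [| lra].
        destruct (L1 Hle). apply Rnot_lt_le. intros Hlt. nra. }
      assert (B2 : rho / 2 <= Y2 q).
      { destruct (Rle_dec (Y2 q) rho) as [Hle |]; [| lra].
        destruct (L2 Hle). apply Rnot_lt_le. intros Hlt. nra. }
      destruct Hor; nra. }
    destruct (Rlt_dec rho (Y1 q)) as [h1 | h1]; [| destruct (Rlt_dec rho (Y2 q)) as [h2 | h2]].
    - apply Rle_trans with (1 := Rle_abs _). apply inverse_product_bound; auto; lra.
    - apply Rle_trans with (1 := Rle_abs _). apply inverse_product_bound; auto; lra.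
    - destruct (L1 ltac:(lra)) as [C1 _]. destruct (L2 ltac:(lra)) as [C2 _].
      apply Rle_trans with 0; [| lra].
      assert (Rabs (X1 q * X2 q) <= Y1 q * Y2 q).
      { rewrite Rabs_mult. apply Rmult_le_compat; auto using Rabs_pos. }
      pose proof (Rle_abs (X1 q * X2 q)).
      apply Rle_div_nonneg; [apply Rmult_lt_0_compat; nra | lra]. }
  apply le_epsilon. intros eps Heps.
  set (E := exp (8 / rho ^ 2 * (t - s2))).
  assert (HE : 0 < E) by apply exp_pos.
  set (d := Rmin (t - s2) (Rmin (rho ^ 2 / 8) (eps / (32 * E)))).
  assert (Hd : 0 < d).
  { repeat apply Rmin_glb_lt; try lra. apply Rdiv_lt_0_compat; lra. }
  assert (d <= t - s2) by apply Rmin_l.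
  assert (d <= rho ^ 2 / 8) by (eapply Rle_trans; [apply Rmin_r | apply Rmin_l]).
  assert (Hde : E * (32 * d) <= eps).
  { assert (d <= eps / (32 * E)) by (eapply Rle_trans; [apply Rmin_r | apply Rmin_r]).
    replace eps with (E * (32 * (eps / (32 * E)))) by (field; lra).
    apply Rmult_le_compat_l; lra. }
  assert (Hg : dist2 X1 Y1 X2 Y2 t
    <= exp (8 / rho ^ 2 * (t - (s2 + d))) * dist2 X1 Y1 X2 Y2 (s2 + d)).
  { eapply gronwall_forward; [lra | |].
    - intros q Hq. apply (dist2_derive v); [apply H1 | apply H2]; lra.
    - intros q Hq. apply Hrate. lra. }
  assert (Hinit : dist2 X1 Y1 X2 Y2 (s2 + d) <= 4 * (4 * (s2 - s1) + e1 + e2) + 32 * d).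
  { destruct (H1 (s2 + d) ltac:(lra)) as ((P1 & _) & L1 & U1).
    destruct (H2 (s2 + d) ltac:(lra)) as ((P2 & _) & L2 & U2).
    destruct L1 as [C1 _]; [apply Rnot_lt_le; intros Hlt; nra |].
    destruct L2 as [C2 _]; [apply Rnot_lt_le; intros Hlt; nra |].
    apply Rabs_le_between in C1, C2. unfold dist2.
    assert (X1 (s2 + d) ^ 2 <= Y1 (s2 + d) ^ 2) by nra.
    assert (X2 (s2 + d) ^ 2 <= Y2 (s2 + d) ^ 2) by nra.
    pose proof (pow2_ge_0 (X1 (s2 + d) + X2 (s2 + d))).
    pose proof (pow2_ge_0 (Y1 (s2 + d) + Y2 (s2 + d))). lra. }
  assert (exp (8 / rho ^ 2 * (t - (s2 + d))) <= E).
  { apply exp_monotone. apply Rmult_le_compat_l; [| lra].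
    apply Rdiv_le_0_compat; lra. }
  pose proof (dist2_nonneg X1 Y1 X2 Y2 (s2 + d)).
  apply Rle_trans with (1 := Hg).
  apply Rle_trans with (E * (4 * (4 * (s2 - s1) + e1 + e2) + 32 * d)).
  - apply Rmult_le_compat; auto. left; apply exp_pos.
  - rewrite Rmult_plus_distr_l. lra.
Qed.

Lemma emerges_unique v rho s T X1 Y1 X2 Y2 t :
  0 < rho -> (forall t, Rabs (v t) * rho <= 1) ->
  emerges v s T X1 Y1 -> emerges v s T X2 Y2 -> s < t <= T ->
  X1 t = X2 t /\ Y1 t = Y2 t.
Proof.
  intros Hr Hv H1 H2 Ht. apply dist2_le_0.
  apply Rle_trans with (1 := fan_stability v rho s 0 s 0 T X1 Y1 X2 Y2 t Hr
    (fan_of_emerges v rho s T X1 Y1 Hr Hv H1) (fan_of_emerges v rho s T X2 Y2 Hr Hv H2)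
    ltac:(nra) ltac:(nra) ltac:(nra) Ht).
  right. ring.
Qed.

Lemma fan_height_bound rho s t :
  0 < rho -> s < t -> exists c, 0 < c /\
  forall v e T X Y, fan v rho s e T X Y -> t <= T -> c <= Y t.
Proof.
  intros Hr Hst. exists (Rmin rho (Rmin 1 (2 * (t - s)))).
  assert (Hc : 0 < Rmin rho (Rmin 1 (2 * (t - s)))) by (repeat apply Rmin_glb_lt; lra).
  split; [assumption |]. intros v e T X Y H Ht.
  destruct (H t ltac:(lra)) as ((P & _) & L & _).
  pose proof (Rmin_l rho (Rmin 1 (2 * (t - s)))).
  pose proof (Rmin_r rho (Rmin 1 (2 * (t - s)))).
  pose proof (Rmin_l 1 (2 * (t - s))). pose proof (Rmin_r 1 (2 * (t - s))).
  destruct (Rle_dec (Y t) rho) as [Hy |]; [| lra].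
  destruct (L Hy). apply Rnot_lt_le. intros Hlt. nra.
Qed.

Lemma Rabs_le_of_dist2 X1 Y1 X2 Y2 t d :
  0 <= d -> dist2 X1 Y1 X2 Y2 t <= d ^ 2 ->
  Rabs (X1 t - X2 t) <= d /\ Rabs (Y1 t - Y2 t) <= d.
Proof.
  unfold dist2. intros Hd H.
  pose proof (pow2_ge_0 (X1 t - X2 t)). pose proof (pow2_ge_0 (Y1 t - Y2 t)).
  rewrite <- (Rabs_pos_eq d Hd). split; apply Rsqr_le_abs_0; unfold Rsqr; lra.
Qed.

Lemma dist2_le_of_Rabs X1 Y1 X2 Y2 t d :
  Rabs (X1 t - X2 t) <= d -> Rabs (Y1 t - Y2 t) <= d ->
  dist2 X1 Y1 X2 Y2 t <= 2 * d ^ 2.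
Proof.
  unfold dist2. intros HX HY.
  apply Rabs_le_between in HX, HY. nra.
Qed.

Lemma cauchy_convergent (a : nat -> R) :
  (forall eps, 0 < eps -> exists N, forall n m, (N <= n)%nat -> (N <= m)%nat ->
     Rabs (a n - a m) <= eps) ->
  exists l, forall eps, 0 < eps -> exists N, forall n, (N <= n)%nat -> Rabs (a n - l) <= eps.
Proof.
  intros H.
  assert (Hc : ex_lim_seq_cauchy a).
  { intros eps. pose proof (cond_pos eps). destruct (H (eps / 2)) as [N HN]; [lra |].
    exists N. intros n m Hn Hm. specialize (HN n m Hn Hm). lra. }
  apply ex_lim_seq_cauchy_corr in Hc. destruct Hc as [l Hl]. exists l.
  intros eps He. apply is_lim_seq_spec in Hl.
  destruct (Hl (mkposreal eps He)) as [N HN]. exists N.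
  intros n Hn. left. apply (HN n Hn).
Qed.

(** The solutions started at [i y], over the driver at time [s], converge at
    time [T] as [y] tends to [0]. Run backward from the limit, the solution
    can neither die after [s], where the approximating solutions are bounded
    below, nor survive at [s], where they are close to the boundary. *)
Lemma emerging_exists v rho s T :
  0 < rho -> (forall t, continuous v t) -> (forall t, Rabs (v t) * rho <= 1) ->
  0 <= s < T -> exists X Y, emerges v s T X Y.
Proof.
  intros Hr Hc Hv HsT.
  assert (Hb : forall t, Rabs (v t) <= / rho).
  { intros t. apply Rabs_le. now apply slope_bound. }
  set (y := fun n => rho / 2 * (1 / 2) ^ n).
  assert (Hpow : forall n, 0 < (1 / 2) ^ n <= 1).
  { intros n. split; [apply pow_lt; lra |].
    apply Rle_trans with (1 ^ n); [apply pow_incr; lra | rewrite pow1; lra]. }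
  assert (Hy : forall n, 0 < y n /\ y n ^ 2 <= rho ^ 2 / 4).
  { intros n. unfold y. pose proof (Hpow n). split; [nra |].
    set (p := (1/2)^n) in *. assert (p ^ 2 <= 1) by nra.
    replace ((rho / 2 * p) ^ 2) with (rho ^ 2 / 4 * p ^ 2) by field. nra. }
  assert (Hysmall : forall eps, 0 < eps -> exists N, forall n, (N <= n)%nat -> y n ^ 2 <= eps).
  { intros eps He. destruct (geometric_lt (rho ^ 2 / 4) eps He) as [N HN].
    exists N. intros n Hn.
    assert ((1/2)^n <= (1/2)^N).
    { replace n with (N + (n - N))%nat by lia. rewrite pow_add.
      pose proof (Hpow N). pose proof (Hpow (n - N)%nat). nra. }
    unfold y. pose proof (Hpow n).
    apply Rle_trans with (rho ^ 2 / 4 * (1/2)^n); [| nra].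
    replace ((rho / 2 * (1/2)^n) ^ 2) with (rho ^ 2 / 4 * ((1/2)^n * (1/2)^n)) by field.
    apply Rmult_le_compat_l; nra. }
  assert (Hex : forall n, exists Z : (R -> R) * (R -> R),
            trajectory v s T (fst Z) (snd Z) /\ fst Z s = 0 /\ snd Z s = y n).
  { intros n. destruct (Hy n) as [Hn _].
    destruct (truncated_flow v (/ rho) (y n) s 0 (y n) Hn Hc Hb) as (X & Y & EX & EY & H).
    exists (X, Y). simpl. split; [| now split].
    apply (truncated_flow_trajectory v (y n)); auto. lra. }
  destruct (choice _ Hex) as [Z HZ]. clear Hex.
  assert (Hfan : forall n, fan v rho s (y n ^ 2) T (fst (Z n)) (snd (Z n))).
  { intros n. destruct (HZ n) as (H & EX & EY). rewrite <- EY.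
    now apply fan_of_vertical_start. }
  set (E := exp (8 / rho ^ 2 * (T - s))).
  assert (HE : 0 < E) by apply exp_pos.
  assert (Hcauchy : forall eps, 0 < eps -> exists N, forall n m, (N <= n)%nat -> (N <= m)%nat ->
            Rabs (fst (Z n) T - fst (Z m) T) <= eps /\ Rabs (snd (Z n) T - snd (Z m) T) <= eps).
  { intros eps He.
    destruct (Hysmall (eps ^ 2 / (8 * E))) as [N HN].
    { apply Rdiv_lt_0_compat; nra. }
    exists N. intros n m Hn Hm. apply Rabs_le_of_dist2; [lra |].
    pose proof (Hy n) as [_ Hyn]. pose proof (Hy m) as [_ Hym].
    apply Rle_trans with (1 := fan_stability v rho s (y n ^ 2) s (y m ^ 2) T _ _ _ _ T Hr
      (Hfan n) (Hfan m) ltac:(nra) (conj (pow2_ge_0 _) Hyn) (conj (pow2_ge_0 _) Hym) ltac:(lra)).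
    fold E. apply Rle_trans with (E * (4 * (4 * (s - s) + eps ^ 2 / (8 * E) + eps ^ 2 / (8 * E)))).
    - apply Rmult_le_compat_l; [lra |]. pose proof (HN n Hn). pose proof (HN m Hm). lra.
    - right. field. lra. }
  destruct (cauchy_convergent (fun n => fst (Z n) T)) as [x1 Hx1].
  { intros eps He. destruct (Hcauchy eps He) as [N HN]. exists N.
    intros n m Hn Hm. now apply HN. }
  destruct (cauchy_convergent (fun n => snd (Z n) T)) as [y1 Hy1].
  { intros eps He. destruct (Hcauchy eps He) as [N HN]. exists N.
    intros n m Hn Hm. now apply HN. }
  assert (Hy1pos : 0 < y1).
  { destruct (fan_height_bound rho s T Hr ltac:(lra)) as (c & Hcp & Hcb).
    destruct (Hy1 (c / 2)) as [N HN]; [lra |]. specialize (HN N (le_n N)).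
    pose proof (Hcb _ _ _ _ _ (Hfan N) (Rle_refl T)).
    apply Rabs_le_between in HN. lra. }
  destruct (backward_dichotomy v (/ rho) T x1 y1 ltac:(lra) Hy1pos Hc Hb)
    as (X & Y & EX & EY & Hcase).
  assert (Happrox : forall t eps, s < t <= T -> trajectory v t T X Y -> 0 < eps ->
            exists n, Rabs (snd (Z n) t - Y t) <= eps /\ y n ^ 2 <= eps).
  { intros t eps Ht Htr He.
    destruct (fan_height_bound rho s t Hr ltac:(lra)) as (c & Hcp & Hcb).
    destruct (Htr t ltac:(lra)) as [Pt _].
    set (c' := Rmin c (Y t)). assert (0 < c') by (now apply Rmin_glb_lt).
    set (G := exp (4 / c' ^ 2 * (T - t))). assert (HG : 0 < G) by apply exp_pos.
    assert (HG1 : 1 <= G).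
    { unfold G. rewrite <- exp_0. apply exp_monotone. apply Rmult_le_pos; [| lra].
      apply Rdiv_le_0_compat; nra. }
    set (d := eps / (2 * G)). assert (Hd : 0 < d) by (apply Rdiv_lt_0_compat; lra).
    assert (EGd : G * (2 * d) = eps) by (unfold d; field; lra).
    destruct (Hx1 d Hd) as [N1 HN1]. destruct (Hy1 d Hd) as [N2 HN2].
    destruct (Hysmall eps He) as [N3 HN3].
    exists (N1 + N2 + N3)%nat. set (n := (N1 + N2 + N3)%nat).
    split; [| apply HN3; unfold n; lia].
    apply (Rabs_le_of_dist2 (fst (Z n)) (snd (Z n)) X Y t eps ltac:(lra)).
    apply Rle_trans with (1 := dist2_backward v t T c' (fst (Z n)) (snd (Z n)) X Y
      H (fan_trajectory _ _ _ _ _ _ _ t (Hfan n) (proj1 Ht)) Htr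
      ltac:(eapply Rle_trans; [apply Rmin_l | apply (Hcb _ _ _ _ _ (Hfan n)); lra])
      (Rmin_r _ _) ltac:(lra)).
    fold G. apply Rle_trans with (G * (2 * d ^ 2)).
    - apply Rmult_le_compat_l; [lra |]. apply dist2_le_of_Rabs.
      + rewrite EX. apply HN1. unfold n; lia.
      + rewrite EY. apply HN2. unfold n; lia.
    - rewrite <- EGd. nra. }
  assert (Hupper : forall t, s < t <= T -> trajectory v t T X Y -> Y t ^ 2 <= 4 * (t - s)).
  { intros t Ht Htr. destruct (Htr t ltac:(lra)) as [Pt _].
    apply Rnot_lt_le. intros Hlt.
    set (g := Y t ^ 2 - 4 * (t - s)) in *.
    set (eps := Rmin (g / 4) (Rmin 1 (g / (8 * Y t)))).
    assert (Hg : 0 < g) by (unfold g; lra).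
    assert (He : 0 < eps).
    { repeat apply Rmin_glb_lt; try lra. apply Rdiv_lt_0_compat; lra. }
    assert (eps <= g / 4) by apply Rmin_l.
    assert (eps <= g / (8 * Y t)) by (eapply Rle_trans; [apply Rmin_r | apply Rmin_r]).
    assert (Y t * eps <= g / 8).
    { replace (g / 8) with (Y t * (g / (8 * Y t))) by (field; lra).
      apply Rmult_le_compat_l; lra. }
    destruct (Happrox t eps Ht Htr He) as (n & Hn & Hyn).
    destruct (Hfan n t Ht) as ((Pn & _) & _ & Un).
    apply Rabs_le_between in Hn.
    assert (Y t ^ 2 <= snd (Z n) t ^ 2 + 2 * eps * Y t).
    { assert (Y t - eps <= snd (Z n) t) by lra.
      destruct (Rle_dec 0 (Y t - eps)); nra. }
    unfold g in *. lra. }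
  assert (Hnotrunning : ~ trajectory v s T X Y).
  { intros Htr. destruct (Htr s ltac:(lra)) as [Ps _].
    set (t := Rmin T (s + Y s ^ 2 / 8)).
    assert (Hst : s < t <= T) by (split; [apply Rmin_glb_lt; nra | apply Rmin_l]).
    assert (t <= s + Y s ^ 2 / 8) by apply Rmin_r.
    pose proof (Hupper t Hst (trajectory_sub v s T t T X Y ltac:(lra) ltac:(lra) Htr)).
    pose proof (trajectory_Y_le v s T X Y s t Htr ltac:(lra) ltac:(lra) ltac:(lra)). nra. }
  exists X, Y.
  destruct Hcase as [Htr | (s' & Hs' & Hem)].
  { exfalso. apply Hnotrunning. apply (trajectory_sub v 0 T); auto; lra. }
  destruct (Rtotal_order s' s) as [Hlt | [-> | Hgt]]; [exfalso | assumption | exfalso].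
  - apply Hnotrunning. now apply (emerges_trajectory v s').
  - destruct (fan_height_bound rho s s' Hr Hgt) as (c & Hcp & Hcb).
    destruct (proj2 Hem (c / 2)) as (t & Ht & Hyt); [lra |].
    destruct (Happrox t (c / 4) ltac:(lra)
      (emerges_trajectory v s' T X Y t Hem (proj1 Ht)) ltac:(lra)) as (n & Hn & _).
    apply Rabs_le_between in Hn.
    pose proof (Hcb _ _ _ _ _ (Hfan n) ltac:(lra)).
    pose proof (trajectory_Y_le v s' T (fst (Z n)) (snd (Z n)) s' t
      (fan_trajectory _ _ _ _ _ _ _ s' (Hfan n) Hgt) ltac:(lra) ltac:(lra) ltac:(lra)). lra.
Qed.

(** * The flow depends holomorphically on its starting point *)

Section Linearized_flow.

Variables (v : R -> R) (T : R) (X Y : R -> R).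
Hypothesis T_pos : 0 < T.
Hypothesis traj : trajectory v 0 T X Y.

(** The coefficient [2 / Z ^ 2] of the linearized equation is only controlled on
    [[0, T]]; it is extended by its end values, so that its primitives are
    differentiable at the end points too. *)
Let clamp (t : R) := Rmin (Rmax t 0) T.
Let p (t : R) := 2 * (X t ^ 2 - Y t ^ 2) / (X t ^ 2 + Y t ^ 2) ^ 2.
Let q (t : R) := - (4 * X t * Y t) / (X t ^ 2 + Y t ^ 2) ^ 2.

Lemma clamp_range t : 0 <= clamp t <= T.
Proof.
  unfold clamp. split; [apply Rmin_glb; [apply Rmax_r | lra] | apply Rmin_r].
Qed.

Lemma clamp_id t : 0 <= t <= T -> clamp t = t.
Proof. intros Ht. unfold clamp. rewrite Rmax_left, Rmin_left; lra. Qed.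

Lemma clamp_continuous t : continuous clamp t.
Proof.
  apply (continuous_Lipschitz clamp 1). intros a b.
  change (Rabs (clamp b - clamp a) <= 1 * Rabs (b - a)).
  unfold clamp, Rmax, Rmin, Rabs.
  repeat destruct Rle_dec; repeat destruct Rcase_abs; lra.
Qed.

Lemma continuous_clamped_ratio (f : R -> R) t :
  (forall t, 0 <= t <= T -> continuous f t) ->
  continuous (fun s => f (clamp s) / (X (clamp s) ^ 2 + Y (clamp s) ^ 2) ^ 2) t.
Proof.
  intros Hf. pose proof (clamp_range t) as Ht.
  destruct (traj (clamp t) Ht) as (P & HX & HY).
  apply (continuous_comp clamp (fun s => f s / (X s ^ 2 + Y s ^ 2) ^ 2));
    [apply clamp_continuous |].
  apply (continuous_mult (K := R_AbsRing)); [now apply Hf |].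
  apply (continuous_Rinv_comp (fun s => (X s ^ 2 + Y s ^ 2) ^ 2)).
  - apply (ex_derive_continuous (fun s => (X s ^ 2 + Y s ^ 2) ^ 2)).
    auto_derive. repeat split; eexists; eassumption.
  - apply pow_nonzero. nra.
Qed.

Lemma is_derive_clamped_RInt (f : R -> R) t :
  (forall s, continuous (fun s => f (clamp s)) s) -> 0 <= t <= T ->
  is_derive (fun s => RInt (fun r => f (clamp r)) 0 s) t (f t).
Proof.
  intros Hf Ht.
  replace (f t) with (f (clamp t)) by (now rewrite clamp_id).
  now apply (is_derive_RInt_upper (fun r => f (clamp r))).
Qed.

(** [Ja + i Jb] is the exponential of the integral of [2 / Z ^ 2]: at time [T] it
    is the complex derivative of the flow. *)
Let P (t : R) := RInt (fun r => p (clamp r)) 0 t.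
Let Q (t : R) := RInt (fun r => q (clamp r)) 0 t.
Let Ja (t : R) := exp (P t) * cos (Q t).
Let Jb (t : R) := exp (P t) * sin (Q t).

Lemma p_clamp_continuous t : continuous (fun s => p (clamp s)) t.
Proof.
  apply (continuous_clamped_ratio (fun s => 2 * (X s ^ 2 - Y s ^ 2))).
  intros s Hs. destruct (traj s Hs) as (_ & HX & HY).
  apply (ex_derive_continuous (fun s => 2 * (X s ^ 2 - Y s ^ 2))).
  auto_derive. repeat split; eexists; eassumption.
Qed.

Lemma q_clamp_continuous t : continuous (fun s => q (clamp s)) t.
Proof.
  apply (continuous_clamped_ratio (fun s => - (4 * X s * Y s))).
  intros s Hs. destruct (traj s Hs) as (_ & HX & HY).
  apply (ex_derive_continuous (fun s => - (4 * X s * Y s))).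
  auto_derive. repeat split; eexists; eassumption.
Qed.

Lemma linearized_flow_derive t : 0 <= t <= T ->
  is_derive Ja t (p t * Ja t - q t * Jb t) /\ is_derive Jb t (q t * Ja t + p t * Jb t).
Proof.
  intros Ht.
  pose proof (is_derive_clamped_RInt p t p_clamp_continuous Ht) as HP. fold (P) in HP.
  pose proof (is_derive_clamped_RInt q t q_clamp_continuous Ht) as HQ. fold (Q) in HQ.
  unfold Ja, Jb. split; auto_derive; try (split; [eexists | split; [eexists | trivial]]; eassumption).
  - rewrite (is_derive_unique (fun x : R => P x) t _ HP), (is_derive_unique (fun x : R => Q x) t _ HQ). ring.
  - rewrite (is_derive_unique (fun x : R => P x) t _ HP), (is_derive_unique (fun x : R => Q x) t _ HQ). ring.
Qed.

Lemma linearized_flow_start : Ja 0 = 1 /\ Jb 0 = 0.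
Proof.
  unfold Ja, Jb, P, Q. rewrite !RInt_point. unfold zero; simpl.
  rewrite exp_0, cos_0, sin_0. lra.
Qed.

Variables (X2 Y2 : R -> R) (c : R).
Hypothesis c_pos : 0 < c.
Hypothesis traj2 : trajectory v 0 T X2 Y2.
Hypothesis above : c <= Y 0.
Hypothesis above2 : c <= Y2 0.

Let dx := X2 0 - X 0.
Let dy := Y2 0 - Y 0.
Let E1 (t : R) := X2 t - X t - (Ja t * dx - Jb t * dy).
Let E2 (t : R) := Y2 t - Y t - (Jb t * dx + Ja t * dy).

(** [D' = (2 / Z ^ 2) D - 2 D ^ 2 / (Z ^ 2 Z2)] for the difference [D]: the last
    term, quadratic in [D], drives the error [E] of the linearization. *)
Lemma linearization_error_derive t : 0 <= t <= T ->
  exists R1 R2,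
    R1 ^ 2 + R2 ^ 2 = 4 * dist2 X2 Y2 X Y t ^ 2
      / ((X t ^ 2 + Y t ^ 2) ^ 2 * (X2 t ^ 2 + Y2 t ^ 2)) /\
    is_derive (fun s => E1 s ^ 2 + E2 s ^ 2) t
      (2 * p t * (E1 t ^ 2 + E2 t ^ 2) + 2 * (E1 t * R1 + E2 t * R2)).
Proof.
  intros Ht.
  destruct (traj t Ht) as (P1 & HX & HY). destruct (traj2 t Ht) as (P2 & HX2 & HY2).
  destruct (linearized_flow_derive t Ht) as [HJa HJb].
  assert (HN : 0 < X t ^ 2 + Y t ^ 2) by nra.
  assert (HN2 : 0 < X2 t ^ 2 + Y2 t ^ 2) by nra.
  set (F1 := - 2 * X2 t / (X2 t ^ 2 + Y2 t ^ 2) + 2 * X t / (X t ^ 2 + Y t ^ 2)).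
  set (F2 := 2 * Y2 t / (X2 t ^ 2 + Y2 t ^ 2) - 2 * Y t / (X t ^ 2 + Y t ^ 2)).
  exists (F1 - (p t * (X2 t - X t) - q t * (Y2 t - Y t))),
         (F2 - (q t * (X2 t - X t) + p t * (Y2 t - Y t))).
  split.
  - unfold F1, F2, p, q, dist2. field. lra.
  - assert (H1 : is_derive E1 t (F1 - ((p t * Ja t - q t * Jb t) * dx - (q t * Ja t + p t * Jb t) * dy))).
    { unfold E1. auto_derive; [repeat split; eexists; eassumption |].
      rewrite (is_derive_unique (fun x : R => X2 x) t _ HX2), (is_derive_unique (fun x : R => X x) t _ HX),
        (is_derive_unique (fun x : R => Ja x) t _ HJa), (is_derive_unique (fun x : R => Jb x) t _ HJb).
      unfold F1. field. simpl in *. lra. }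
    assert (H2 : is_derive E2 t (F2 - ((q t * Ja t + p t * Jb t) * dx + (p t * Ja t - q t * Jb t) * dy))).
    { unfold E2. auto_derive; [repeat split; eexists; eassumption |].
      rewrite (is_derive_unique (fun x : R => Y2 x) t _ HY2), (is_derive_unique (fun x : R => Y x) t _ HY),
        (is_derive_unique (fun x : R => Ja x) t _ HJa), (is_derive_unique (fun x : R => Jb x) t _ HJb).
      unfold F2. field. simpl in *. lra. }
    replace (2 * p t * _ + _) with
      (plus (2 * E1 t * (F1 - ((p t * Ja t - q t * Jb t) * dx - (q t * Ja t + p t * Jb t) * dy)))
            (2 * E2 t * (F2 - ((q t * Ja t + p t * Jb t) * dx + (p t * Ja t - q t * Jb t) * dy)))).
    + apply (is_derive_plus (V := R_NormedModule) (fun s => E1 s ^ 2) (fun s => E2 s ^ 2));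
        now apply is_derive_sqr.
    + unfold plus; simpl. unfold E1, E2. ring.
Qed.

Lemma linearization_error_bound :
  E1 T ^ 2 + E2 T ^ 2
    <= exp ((4 / c ^ 2 + 1) * T)
       * (4 * exp (4 / c ^ 2 * T) ^ 2 / c ^ 6 / (4 / c ^ 2 + 1)) * (dx ^ 2 + dy ^ 2) ^ 2.
Proof.
  set (K := 4 / c ^ 2 + 1). set (G := exp (4 / c ^ 2 * T)).
  set (d := dx ^ 2 + dy ^ 2).
  assert (Hc2 : 0 < c ^ 2) by nra. assert (Hc6 : 0 < c ^ 6) by (now apply pow_lt).
  assert (H4c : 0 < 4 / c ^ 2) by (apply Rdiv_lt_0_compat; lra).
  assert (HK : 0 < K) by (unfold K; lra).
  assert (HG : 0 < G) by apply exp_pos.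
  (* [M] bounds the square of the quadratic remainder [2 D ^ 2 / (Z ^ 2 Z2)]. *)
  set (M := 4 * G ^ 2 / c ^ 6 * d ^ 2).
  assert (Hd : 0 <= d) by (unfold d; nra).
  assert (HM : 0 <= M).
  { apply Rmult_le_pos; [| apply pow2_ge_0]. apply Rdiv_le_0_compat; nra. }
  assert (Hex : forall t, exists l, 0 <= t <= T ->
    is_derive (fun s => E1 s ^ 2 + E2 s ^ 2) t l /\ l <= K * (E1 t ^ 2 + E2 t ^ 2) + M).
  { intros t. destruct (classic (0 <= t <= T)) as [Ht | Ht]; [| exists 0; now intros].
    destruct (linearization_error_derive t Ht) as (R1 & R2 & HR & HE).
    eexists. intros _. split; [exact HE |].
    destruct (traj t Ht) as (P1 & _). destruct (traj2 t Ht) as (P2 & _).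
    pose proof (trajectory_Y_le v 0 T X Y 0 t traj ltac:(lra) ltac:(lra) ltac:(lra)).
    pose proof (trajectory_Y_le v 0 T X2 Y2 0 t traj2 ltac:(lra) ltac:(lra) ltac:(lra)).
    assert (HN : c ^ 2 <= X t ^ 2 + Y t ^ 2) by nra.
    assert (HN2 : c ^ 2 <= X2 t ^ 2 + Y2 t ^ 2) by nra.
    assert (Hdist : dist2 X2 Y2 X Y t <= G * d).
    { apply Rle_trans with (1 := dist2_forward v 0 t c X2 Y2 X Y c_pos
        (trajectory_sub v 0 T 0 t _ _ ltac:(lra) (proj2 Ht) traj2)
        (trajectory_sub v 0 T 0 t _ _ ltac:(lra) (proj2 Ht) traj) above2 above (proj1 Ht)).
      apply Rmult_le_compat; [left; apply exp_pos | apply dist2_nonneg | |].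
      - apply exp_monotone. apply Rmult_le_compat_l; lra.
      - apply Rle_refl. }
    assert (Hp : 2 * p t <= 4 / c ^ 2).
    { unfold p.
      apply Rle_trans with (4 / (X t ^ 2 + Y t ^ 2)).
      - apply Rmult_le_reg_r with ((X t ^ 2 + Y t ^ 2) ^ 2); [apply pow_lt; lra |].
        replace (2 * (2 * (X t ^ 2 - Y t ^ 2) / (X t ^ 2 + Y t ^ 2) ^ 2) * (X t ^ 2 + Y t ^ 2) ^ 2)
          with (4 * (X t ^ 2 - Y t ^ 2)) by (field; lra).
        replace (4 / (X t ^ 2 + Y t ^ 2) * (X t ^ 2 + Y t ^ 2) ^ 2)
          with (4 * (X t ^ 2 + Y t ^ 2)) by (field; lra). nra.
      - apply Rmult_le_compat_l; [lra |]. apply Rinv_le_contravar; lra. }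
    assert (HRM : R1 ^ 2 + R2 ^ 2 <= M).
    { rewrite HR. unfold M.
      replace (4 * G ^ 2 / c ^ 6 * d ^ 2) with (4 * (G * d) ^ 2 * / c ^ 6) by (field; lra).
      apply Rmult_le_compat.
      - pose proof (pow2_ge_0 (dist2 X2 Y2 X Y t)). lra.
      - left. apply Rinv_0_lt_compat. apply Rmult_lt_0_compat; [apply pow_lt |]; lra.
      - apply Rmult_le_compat_l; [lra |]. apply pow_incr. split; [apply dist2_nonneg | assumption].
      - apply Rinv_le_contravar; [assumption |].
        replace (c ^ 6) with ((c ^ 2) ^ 2 * c ^ 2) by ring.
        apply Rmult_le_compat; try lra; [nra | apply pow_incr; lra]. }
    pose proof (pow2_ge_0 (E1 t - R1)). pose proof (pow2_ge_0 (E2 t - R2)).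
    assert (2 * p t * (E1 t ^ 2 + E2 t ^ 2) <= 4 / c ^ 2 * (E1 t ^ 2 + E2 t ^ 2)).
    { apply Rmult_le_compat_r; [nra | assumption]. }
    unfold K. lra. }
  destruct (choice _ Hex) as [l Hl].
  assert (H : E1 T ^ 2 + E2 T ^ 2 + M / K
              <= exp (K * (T - 0)) * (E1 0 ^ 2 + E2 0 ^ 2 + M / K)).
  { apply (gronwall_forward (fun s => E1 s ^ 2 + E2 s ^ 2 + M / K) l); [lra | |].
    - intros t Ht. replace (l t) with (plus (l t) 0) by (unfold plus; simpl; ring).
      apply (is_derive_plus (V := R_NormedModule) (fun s => E1 s ^ 2 + E2 s ^ 2) (fun _ => M / K)).
      + now apply Hl.
      + apply (is_derive_const (V := R_NormedModule)).
    - intros t Ht. destruct (Hl t Ht) as [_ H].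
      replace (K * (E1 t ^ 2 + E2 t ^ 2 + M / K)) with (K * (E1 t ^ 2 + E2 t ^ 2) + M)
        by (field; lra). exact H. }
  destruct linearized_flow_start as [HJa HJb].
  assert (E10 : E1 0 = 0) by (unfold E1; rewrite HJa, HJb; unfold dx; ring).
  assert (E20 : E2 0 = 0) by (unfold E2; rewrite HJa, HJb; unfold dy; ring).
  rewrite E10, E20, Rminus_0_r in H.
  assert (0 <= M / K) by (apply Rdiv_le_0_compat; lra).
  apply Rle_trans with (exp (K * T) * (M / K)); [lra |].
  right. unfold M. field. lra.
Qed.

End Linearized_flow.

Lemma flow_differentiable v T X Y :
  0 < T -> trajectory v 0 T X Y ->
  exists a b B, 0 < B /\ forall X2 Y2, trajectory v 0 T X2 Y2 -> Y 0 / 2 <= Y2 0 ->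
    (X2 T - X T - (a * (X2 0 - X 0) - b * (Y2 0 - Y 0))) ^ 2
    + (Y2 T - Y T - (b * (X2 0 - X 0) + a * (Y2 0 - Y 0))) ^ 2
    <= B ^ 2 * ((X2 0 - X 0) ^ 2 + (Y2 0 - Y 0) ^ 2) ^ 2.
Proof.
  intros HT H. destruct (H 0) as [P0 _]; [lra |].
  set (c := Y 0 / 2). assert (Hc : 0 < c) by (unfold c; lra).
  set (C := exp ((4 / c ^ 2 + 1) * T)
       * (4 * exp (4 / c ^ 2 * T) ^ 2 / c ^ 6 / (4 / c ^ 2 + 1))).
  assert (HC : 0 < C).
  { assert (0 < 4 / c ^ 2) by (apply Rdiv_lt_0_compat; [lra | now apply pow_lt]).
    apply Rmult_lt_0_compat; [apply exp_pos |].
    repeat apply Rdiv_lt_0_compat; try lra; [| now apply pow_lt].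
    apply Rmult_lt_0_compat; [lra | apply pow_lt, exp_pos]. }
  do 3 eexists. split; [| intros X2 Y2 H2 Ha].
  2: { apply Rle_trans with (1 := linearization_error_bound v T X Y HT H X2 Y2 c Hc H2
         ltac:(unfold c; lra) Ha).
       fold C. apply Rmult_le_compat_r; [apply pow2_ge_0 |].
       instantiate (1 := C + 1). nra. }
  lra.
Qed.

(** * Drivers with a bounded continuous derivative generate simple curves *)

Lemma complex_derivative_of_quadratic_error (f : C -> C) (z : C) (a b B d : R) :
  0 < B -> 0 < d ->
  (forall w, Cmod (w - z) < d ->
     (fst (f w) - fst (f z) - (a * (fst w - fst z) - b * (snd w - snd z))) ^ 2
     + (snd (f w) - snd (f z) - (b * (fst w - fst z) + a * (snd w - snd z))) ^ 2
     <= B ^ 2 * ((fst w - fst z) ^ 2 + (snd w - snd z) ^ 2) ^ 2) ->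
  ex_derive (K := C_AbsRing) (V := C_NormedModule) f z.
Proof.
  intros HB Hd H. exists ((a, b) : C). split; [apply @is_linear_scal_l |].
  intros x Hx. apply (is_filter_lim_locally_unique (V := AbsRing_NormedModule C_AbsRing)) in Hx. subst x.
  intros eps. apply (locally_le_locally_norm (V := AbsRing_NormedModule C_AbsRing)).
  assert (He : 0 < Rmin d (eps / B)).
  { apply Rmin_glb_lt; [assumption |]. apply Rdiv_lt_0_compat; [apply cond_pos | assumption]. }
  exists (mkposreal _ He). intros w Hw.
  change (Cmod (w - z) < Rmin d (eps / B)) in Hw.
  change (Cmod ((f w - f z) - (w - z) * (a, b)) <= eps * Cmod (w - z)).
  assert (Hwd : Cmod (w - z) < d) by (apply Rlt_le_trans with (1 := Hw), Rmin_l).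
  assert (Hwe : B * Cmod (w - z) <= eps).
  { apply Rle_trans with (B * (eps / B)); [| right; field; lra].
    apply Rmult_le_compat_l; [lra |]. left. apply Rlt_le_trans with (1 := Hw), Rmin_r. }
  assert (Hm : Cmod (w - z) ^ 2 = (fst w - fst z) ^ 2 + (snd w - snd z) ^ 2).
  { unfold Cmod. rewrite pow2_sqrt; [reflexivity |].
    apply Rplus_le_le_0_compat; apply pow2_ge_0. }
  apply Rle_trans with (B * Cmod (w - z) ^ 2).
  - unfold Cmod at 1. rewrite <- (sqrt_pow2 (B * Cmod (w - z) ^ 2)).
    + apply sqrt_le_1_alt. rewrite Rpow_mult_distr, Hm.
      apply Rle_trans with (2 := H w Hwd). right. simpl. ring.
    + apply Rmult_le_pos; [lra | apply pow2_ge_0].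
  - pose proof (Cmod_ge_0 (w - z)). nra.
Qed.

Lemma is_derive_pair (f g : R -> R) (t l m : R) :
  is_derive f t l -> is_derive g t m ->
  is_derive (V := C_R_NormedModule) (fun s => (f s, g s)) t (l, m).
Proof.
  intros Hf Hg.
  apply (is_derive_ext (V := C_R_NormedModule) (fun s => plus (scal (f s) ((1, 0) : C))
                                  (scal (g s) ((0, 1) : C)))).
  - intros s. unfold plus, scal; simpl. unfold prod_plus, prod_scal, plus, scal; simpl.
    unfold mult; simpl. f_equal; ring.
  - replace ((l, m) : C) with
      (plus (G := C_R_NormedModule) (scal l ((1, 0) : C)) (scal m ((0, 1) : C))).
    + apply (is_derive_plus (V := C_R_NormedModule));
        now apply (is_derive_scal_l (V := C_R_NormedModule)).
    + unfold plus, scal; simpl. unfold prod_plus, prod_scal, plus, scal; simpl.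
      unfold mult; simpl. f_equal; ring.
Qed.

Lemma is_derive_within_of_is_derive {V : NormedModule R_AbsRing} (D : R -> Prop)
    (f : R -> V) (t : R) (l : V) :
  D t -> is_derive f t l -> is_derive_within D f t l.
Proof.
  intros Ht H. unfold is_derive_within.
  assert (HF : ProperFilter (within D (locally t))).
  { constructor; [| apply within_filter, locally_filter].
    intros P [d Hd]. exists t. apply Hd; [apply ball_center | assumption]. }
  apply (filterdiff_locally (F := within D (locally t)) f t); [| exact H].
  intros P [d Hd]. exists d. intros y Hy _. now apply Hd.
Qed.

Section Simple_curve.

Variables (v xi : R -> R) (rho T : R).
Hypothesis T_pos : 0 < T.
Hypothesis rho_pos : 0 < rho.
Hypothesis v_continuous : forall t, continuous v t.
Hypothesis v_bounded : forall t, Rabs (v t) * rho <= 1.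
Hypothesis xi_derive : forall t, is_derive xi t (v t).

Lemma v_bounded_inv t : Rabs (v t) <= / rho.
Proof. apply Rabs_le. now apply slope_bound. Qed.

Lemma forward_trajectory (z : C) :
  exists Z : (R -> R) * (R -> R), upper_half_plane z ->
    trajectory v 0 T (fst Z) (snd Z) /\ fst Z 0 = Re z - xi 0 /\ snd Z 0 = Im z.
Proof.
  destruct (Rlt_dec 0 (Im z)) as [Hz | Hz].
  - destruct (truncated_flow v (/ rho) (Im z) 0 (Re z - xi 0) (Im z) Hz
                v_continuous v_bounded_inv) as (X & Y & EX & EY & H).
    exists (X, Y). simpl. intros _. split; [| now split].
    apply (truncated_flow_trajectory v (Im z)); auto. lra.
  - exists (fun _ => 0, fun _ => 0). intros; contradiction.
Qed.

Lemma emerging_trajectory (s : R) :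
  exists Z : (R -> R) * (R -> R), 0 <= s < T -> emerges v s T (fst Z) (snd Z).
Proof.
  destruct (classic (0 <= s < T)) as [Hs | Hs].
  - destruct (emerging_exists v rho s T) as (X & Y & H); auto. now exists (X, Y).
  - exists (fun _ => 0, fun _ => 0). intros; contradiction.
Qed.

Theorem simple_curve_of_bounded_derivative : generates_simple_curve T xi.
Proof.
  destruct (choice _ forward_trajectory) as [F HF].
  destruct (choice _ emerging_trajectory) as [G HG].
  set (h := fun t z => (xi t + fst (F z) t, snd (F z) t) : C).
  set (tip := fun t => if Rle_dec t 0 then (0, 0)
                       else (fst (G (T - t)) T, snd (G (T - t)) T)).
  set (gamma := fun t => (xi T + fst (tip t), snd (tip t)) : C).
  assert (Htip0 : tip 0 = (0, 0)).
  { unfold tip. destruct (Rle_dec 0 0); [reflexivity | lra]. }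
  assert (Htip : forall t, 0 < t -> tip t = (fst (G (T - t)) T, snd (G (T - t)) T)).
  { intros t Ht. unfold tip. destruct (Rle_dec t 0); [lra | reflexivity]. }
  assert (Hpos : forall t, 0 < t <= T -> 0 < snd (tip t)).
  { intros t Ht. rewrite Htip by lra.
    destruct (HG (T - t) ltac:(lra)) as [H _]. now destruct (H T ltac:(lra)). }
  assert (Hgfan : forall t, 0 < t <= T ->
            fan v rho (T - t) 0 T (fst (G (T - t))) (snd (G (T - t)))).
  { intros t Ht. apply fan_of_emerges; auto. apply HG. lra. }
  (* A solution that is still in the half-plane at the time at which another
     one emerges never meets it. *)
  assert (Hdisjoint : forall s X Y X2 Y2, s < T -> trajectory v s T X Y ->
            emerges v s T X2 Y2 -> X T = X2 T -> Y T = Y2 T -> False).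
  { intros s X Y X2 Y2 Hs H H2 EX EY.
    destruct (H s) as [Ps _]; [lra |].
    destruct (proj2 H2 (Y s) Ps) as (t & Ht & Hlt).
    destruct (trajectory_backward_unique v t T X Y X2 Y2) as [_ E]; auto; try lra.
    - apply (trajectory_sub v s T); auto; lra.
    - apply (emerges_trajectory v s); auto; lra.
    - pose proof (trajectory_Y_le v s T X Y s t H); lra. }
  (* The curve is Hölder continuous of exponent [1 / 2]; at its foot on the
     line the stability estimate is replaced by the width of the fan. *)
  assert (Hholder : forall t t', 0 <= t <= t' -> t' <= T -> t' <= t + rho ^ 2 / 16 ->
            (fst (tip t) - fst (tip t')) ^ 2 + (snd (tip t) - snd (tip t')) ^ 2
            <= 16 * exp (8 / rho ^ 2 * T) * (t' - t)).
  { intros t t' Ht Ht' Hclose.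
    assert (HE : 1 <= exp (8 / rho ^ 2 * T)).
    { rewrite <- exp_0. apply exp_monotone. apply Rmult_le_pos; [| lra].
      apply Rdiv_le_0_compat; nra. }
    destruct (Rle_lt_or_eq_dec 0 t (proj1 Ht)) as [Hpt | <-].
    - rewrite !Htip by lra. cbn [fst snd].
      apply Rle_trans with
        (dist2 (fst (G (T - t'))) (snd (G (T - t'))) (fst (G (T - t))) (snd (G (T - t))) T);
        [unfold dist2; right; ring |].
      apply Rle_trans with (1 := fan_stability v rho (T - t') 0 (T - t) 0 T _ _ _ _ T rho_pos
        (Hgfan t' ltac:(lra)) (Hgfan t ltac:(lra)) ltac:(lra) ltac:(nra) ltac:(nra) ltac:(lra)).
      apply Rle_trans with (exp (8 / rho ^ 2 * T) * (4 * (4 * ((T - t) - (T - t')) + 0 + 0)));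
        [| right; ring].
      apply Rmult_le_compat_r; [lra |]. apply exp_monotone. apply Rmult_le_compat_l; [| lra].
      apply Rdiv_le_0_compat; nra.
    - destruct (Rle_lt_or_eq_dec 0 t' (proj2 Ht)) as [Hpt' | <-].
      + rewrite Htip0, Htip by lra. cbn [fst snd].
        destruct (Hgfan t' ltac:(lra) T ltac:(lra)) as ((P & _) & L & U).
        destruct L as [L _].
        { apply Rnot_lt_le. intros Hlt. nra. }
        apply Rabs_le_between in L. nra.
      + rewrite Htip0. cbn [fst snd]. lra. }
  exists h, gamma. split; [| split; [| split; [| split; [| split]]]].
  - intros z Hz. destruct (HF z Hz) as (Htr & E1 & E2). split.
    + unfold h. rewrite E1, E2. apply injective_projections; simpl; [unfold Re; ring | reflexivity].
    + intros t Ht. destruct (Htr t Ht) as (P & HX & HY). split.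
      * intros E. apply (f_equal snd) in E. simpl in E. lra.
      * apply is_derive_within_of_is_derive; [assumption |].
        replace (RtoC (-2) / (h t z - RtoC (xi t)))%C with
          ((v t + (- 2 * fst (F z) t / (fst (F z) t ^ 2 + snd (F z) t ^ 2) - v t),
            2 * snd (F z) t / (fst (F z) t ^ 2 + snd (F z) t ^ 2)) : C).
        -- apply is_derive_pair; [| assumption].
           now apply (is_derive_plus (V := R_NormedModule) xi).
        -- replace (h t z - RtoC (xi t))%C with ((fst (F z) t, snd (F z) t) : C)
             by (unfold h; apply injective_projections; simpl; ring).
           unfold Cdiv, Cmult, Cinv, RtoC; simpl. apply injective_projections; simpl; field; nra.
  - intros t0 Ht0. apply (filterlim_locally (U := C_UniformSpace)). intros eps.
    pose proof (cond_pos eps) as Heps.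
    set (C0 := 16 * exp (8 / rho ^ 2 * T)).
    assert (HC0 : 0 < C0) by (apply Rmult_lt_0_compat; [lra | apply exp_pos]).
    set (d := Rmin (rho ^ 2 / 16) (eps ^ 2 / (2 * C0))).
    assert (Hd : 0 < d).
    { apply Rmin_glb_lt; [nra |]. apply Rdiv_lt_0_compat; [now apply pow_lt | lra]. }
    assert (Hd1 : d <= rho ^ 2 / 16) by apply Rmin_l.
    assert (Hd2 : C0 * d < eps ^ 2).
    { assert (d <= eps ^ 2 / (2 * C0)) by apply Rmin_r.
      apply Rle_lt_trans with (C0 * (eps ^ 2 / (2 * C0))); [apply Rmult_le_compat_l; lra |].
      replace (C0 * (eps ^ 2 / (2 * C0))) with (eps ^ 2 / 2) by (field; lra).
      assert (0 < eps ^ 2) by (now apply pow_lt). lra. }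
    exists (mkposreal d Hd). intros t Hball Ht. change (Rabs (t - t0) < d) in Hball.
    assert (Hle : (fst (tip t) - fst (tip t0)) ^ 2 + (snd (tip t) - snd (tip t0)) ^ 2 < eps ^ 2).
    { unfold Icc in *. apply Rabs_def2 in Hball. apply Rle_lt_trans with (2 := Hd2).
      destruct (Rle_dec t t0) as [Hle | Hle].
      - apply Rle_trans with (1 := Hholder t t0 ltac:(lra) ltac:(lra) ltac:(lra)).
        fold C0. apply Rmult_le_compat_l; lra.
      - replace ((fst (tip t) - fst (tip t0)) ^ 2 + (snd (tip t) - snd (tip t0)) ^ 2)
          with ((fst (tip t0) - fst (tip t)) ^ 2 + (snd (tip t0) - snd (tip t)) ^ 2) by ring.
        apply Rle_trans with (1 := Hholder t0 t ltac:(lra) ltac:(lra) ltac:(lra)).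
        fold C0. apply Rmult_le_compat_l; lra. }
    pose proof (pow2_ge_0 (fst (tip t) - fst (tip t0))).
    pose proof (pow2_ge_0 (snd (tip t) - snd (tip t0))).
    split.
    + change (Rabs (xi T + fst (tip t) - (xi T + fst (tip t0))) < eps).
      replace (xi T + fst (tip t) - (xi T + fst (tip t0))) with (fst (tip t) - fst (tip t0)) by ring.
      rewrite <- (Rabs_pos_eq eps) by lra. apply Rsqr_lt_abs_0. unfold Rsqr. lra.
    + change (Rabs (snd (tip t) - snd (tip t0)) < eps).
      rewrite <- (Rabs_pos_eq eps) by lra. apply Rsqr_lt_abs_0. unfold Rsqr. lra.
  - assert (Hinj : forall s t, Icc 0 T s -> Icc 0 T t -> s < t -> gamma s = gamma t -> False).
    { intros s t Hs Ht Hst E. unfold Icc in *. unfold gamma in E.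
      assert (E1 : fst (tip s) = fst (tip t)) by (apply (f_equal fst) in E; simpl in E; lra).
      assert (E2 : snd (tip s) = snd (tip t)) by (apply (f_equal snd) in E; exact E).
      pose proof (Hpos t ltac:(lra)) as Pt.
      destruct (Rle_lt_or_eq_dec 0 s (proj1 Hs)) as [Hps | <-].
      - rewrite !Htip in E1, E2 by lra. simpl in E1, E2.
        apply (Hdisjoint (T - s) (fst (G (T - t))) (snd (G (T - t)))
                 (fst (G (T - s))) (snd (G (T - s)))); auto; try lra.
        + apply (emerges_trajectory v (T - t)); [apply HG; lra | lra].
        + apply HG. lra.
      - rewrite Htip0 in E2. simpl in E2. lra. }
    intros s t Hs Ht E. destruct (Rtotal_order s t) as [Hlt | [Heq | Hgt]]; [exfalso | assumption | exfalso].
    + now apply (Hinj s t).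
    + now apply (Hinj t s).
  - unfold gamma. rewrite Htip0. simpl. unfold RtoC. f_equal. ring.
  - intros t Ht. now apply Hpos.
  - split; [| split].
    + intros z Hz. destruct (HF z Hz) as (Htr & E1 & E2).
      destruct (flow_differentiable v T _ _ T_pos Htr) as (a & b & B & HB & Hq).
      unfold upper_half_plane, Im in Hz.
      apply (complex_derivative_of_quadratic_error _ z a b B (snd z / 2)); auto; [lra |].
      intros w Hw.
      assert (Hwz : Rabs (snd w - snd z) < snd z / 2).
      { apply Rle_lt_trans with (2 := Hw).
        apply Rle_trans with (2 := Rmax_Cmod _). apply Rmax_r. }
      apply Rabs_def2 in Hwz.
      assert (Huw : upper_half_plane w) by (unfold upper_half_plane, Im; lra).
      destruct (HF w Huw) as (Htrw & E1w & E2w).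
      specialize (Hq _ _ Htrw). rewrite E1, E2, E1w, E2w in Hq. unfold Re, Im in Hq.
      replace (fst w - fst z) with (fst w - xi 0 - (fst z - xi 0)) by ring.
      replace (fst (h T w) - fst (h T z)) with (fst (F w) T - fst (F z) T)
        by (unfold h; simpl; ring).
      apply Hq. lra.
    + intros z w Hz Hw E. destruct (HF z Hz) as (Htr & E1 & E2).
      destruct (HF w Hw) as (Htrw & E1w & E2w).
      unfold h in E. pose proof (f_equal fst E) as EX. pose proof (f_equal snd E) as EY.
      simpl in EX, EY.
      destruct (trajectory_backward_unique v 0 T _ _ _ _ ltac:(lra) Htr Htrw) as [EX0 EY0];
        [lra | assumption |].
      rewrite E1, E1w in EX0. rewrite E2, E2w in EY0.
      apply injective_projections; [| exact EY0]. unfold Re in EX0. lra.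
    + intros w. split.
      * intros [Hw Hng].
        destruct (backward_dichotomy v (/ rho) T (Re w - xi T) (Im w) T_pos Hw
                    v_continuous v_bounded_inv) as (X & Y & EX & EY & [Htr | (s & Hs & Hem)]).
        -- set (z := (xi 0 + X 0, Y 0) : C).
           assert (Hz : upper_half_plane z).
           { destruct (Htr 0) as [P _]; [lra |]. exact P. }
           exists z. split; [assumption |].
           destruct (HF z Hz) as (Htrz & E1 & E2). simpl in E1, E2.
           destruct (trajectory_forward_unique v 0 T _ _ _ _ ltac:(lra) Htrz Htr) as [EXT EYT];
             [rewrite E1; ring | assumption |].
           unfold h. rewrite EXT, EYT, EX, EY.
           apply injective_projections; simpl; [unfold Re; ring | reflexivity].
        -- exfalso. apply Hng. exists (T - s). split; [lra |].
           unfold gamma. rewrite Htip by lra. simpl.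
           replace (T - (T - s)) with s by ring.
           destruct (emerges_unique v rho s T X Y (fst (G s)) (snd (G s)) T) as [EX' EY'];
             auto; try lra.
           rewrite <- EX', <- EY', EX, EY.
           apply injective_projections; simpl; [unfold Re; ring | reflexivity].
      * intros (z & Hz & <-). destruct (HF z Hz) as (Htr & E1 & E2). split.
        -- destruct (Htr T) as [P _]; [lra | exact P].
        -- intros (t & Ht & E). unfold h, gamma in E. rewrite Htip in E by lra.
           pose proof (f_equal fst E) as EX. pose proof (f_equal snd E) as EY. simpl in EX, EY.
           apply (Hdisjoint (T - t) (fst (F z)) (snd (F z))
                    (fst (G (T - t))) (snd (G (T - t)))); auto; try lra.
           ++ apply (trajectory_sub v 0 T); auto; lra.
           ++ apply HG. lra.
Qed.

End Simple_curve.

(** * Hitting times *)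

Lemma LimInf_left_eq_0 (D : R -> Prop) (f : R -> R) (t : R) :
  (forall s, D s -> 0 <= f s) ->
  (forall eps delta, 0 < eps -> 0 < delta -> exists s, D s /\ t - delta < s < t /\ f s < eps) ->
  LimInf_left D f t = Finite 0.
Proof.
  intros Hpos Hsmall.
  assert (Hglb : forall delta, 0 < delta ->
    Glb_Rbar (fun y => exists s, D s /\ t - delta < s < t /\ y = f s) = Finite 0).
  { intros delta Hd. apply is_glb_Rbar_unique. split.
    - intros y (s & Hs & _ & ->). now apply Hpos.
    - intros b Hb. destruct b as [b | |]; [| | exact I].
      + simpl. apply Rnot_lt_le. intros Hlt.
        destruct (Hsmall b delta Hlt Hd) as (s & Hs & Hst & Hf).
        specialize (Hb (f s) (ex_intro _ s (conj Hs (conj Hst eq_refl)))). simpl in Hb. lra.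
      + destruct (Hsmall 1 delta Rlt_0_1 Hd) as (s & Hs & Hst & _).
        exact (Hb (f s) (ex_intro _ s (conj Hs (conj Hst eq_refl)))). }
  apply Rbar_is_lub_unique. split.
  - intros v (delta & Hd & ->). rewrite (Hglb delta Hd). apply Rbar_le_refl.
  - intros b Hb. apply Hb. exists 1. split; [lra |]. symmetry. now apply Hglb, Rlt_0_1.
Qed.

(** An empty [D] is included, where the limit is [p_infty]: a solution does not
    hit the driver at time [0]. *)
Lemma LimInf_left_neq_0 (D : R -> Prop) (f : R -> R) (t m : R) :
  0 < m -> (forall s, D s -> m <= f s) -> LimInf_left D f t <> Finite 0.
Proof.
  intros Hm Hf E.
  set (E1 := fun y => exists s, D s /\ t - 1 < s < t /\ y = f s).
  assert (H1 : Rbar_le (Finite m) (Glb_Rbar E1)).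
  { apply (proj2 (Glb_Rbar_correct E1)). intros y (s & Hs & _ & ->). now apply Hf. }
  assert (H2 : Rbar_le (Glb_Rbar E1) (LimInf_left D f t)).
  { unfold LimInf_left, Rbar_lub. apply (proj1 (proj2_sig (Rbar_ex_lub _))).
    exists 1. split; [lra | reflexivity]. }
  pose proof (Rbar_le_trans _ _ _ H1 H2) as H. rewrite E in H. simpl in H. lra.
Qed.

Lemma is_derive_of_within_interior {V : NormedModule R_AbsRing} (D : R -> Prop)
    (f : R -> V) (t : R) (l : V) :
  locally t D -> is_derive_within D f t l -> is_derive f t l.
Proof.
  intros HD [Hlin Hdom]. split; [assumption |].
  intros x Hx eps.
  apply (filter_imp (fun y => D y /\ (D y ->
    norm (minus (minus (f y) (f x)) (scal (minus y x) l)) <= eps * norm (minus y x)))).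
  - intros y [Hy H]. now apply H.
  - apply filter_and; [assumption |].
    assert (Hlim : is_filter_lim (within D (locally t)) x).
    { intros P HP. apply (filter_le_within D). now apply Hx. }
    exact (Hdom x Hlim eps).
Qed.

Lemma right_continuous_of_derive_within (g : R -> R) (t l : R) :
  0 < t -> is_derive_within (Ico 0 t) g 0 l -> continuous (fun r => g (Rmax r 0)) 0.
Proof.
  intros Ht H. unfold continuous. rewrite Rmax_left by lra.
  assert (Hin : Filter (within (Ico 0 t) (locally 0))) by (apply within_filter, locally_filter).
  apply (filterlim_comp _ _ _ (fun r => Rmax r 0) g (locally 0) (within (Ico 0 t) (locally 0))).
  - intros P [d Hd].
    assert (Hm : 0 < Rmin d t) by (apply Rmin_glb_lt; [apply cond_pos | assumption]).
    exists (mkposreal _ Hm). intros r Hr. change (Rabs (r - 0) < Rmin d t) in Hr.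
    pose proof (Rmin_l d t). pose proof (Rmin_r d t). pose proof (cond_pos d).
    rewrite Rminus_0_r in Hr. apply Rabs_def2 in Hr. apply Hd.
    + change (Rabs (Rmax r 0 - 0) < d).
      apply Rabs_def1; unfold Rmax; destruct Rle_dec; lra.
    + unfold Ico, Rmax; destruct Rle_dec; lra.
  - apply (filterdiff_continuous_aux (F := within (Ico 0 t) (locally 0)) g).
    + eexists. exact H.
    + intros P [d Hd]. exists d. intros y Hy _. now apply Hd.
Qed.

(** * A driver that outruns the flow *)

(** The point [X = sqrt (4 (t + d) (1 - t) / (1 + d))], seen from the driver, is
    swallowed at time [1] exactly; the driver follows from
    [xi' = - 2 / X - X']. As [d] tends to [0] the driver approaches one that
    starts like [- 4 sqrt t], the critical speed at which the driver keeps its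
    distance from a point that it could have swallowed at once. *)
Definition gap_sqr (d t : R) : R := 4 * (t + d) * (1 - t) / (1 + d).

(** On [[0, 1]] this is [- 2 / X - X'] in closed form; the maxima extend it to a
    bounded continuous function on the line. *)
Definition slope (d t : R) : R :=
  - 2 * sqrt (Rmax (1 - Rmax t 0) 0 / ((1 + d) * (Rmax t 0 + d))).

(** The driver stands still until time [d], which is long enough for the point to
    be swallowed; the slope is switched on gradually to keep the derivative
    continuous. *)
Definition delayed_slope (d t : R) : R :=
  slope d t * Rmin (Rmax ((t - d) / d) 0) 1.

Definition driver (v : R -> R) (t : R) : R := RInt v 0 t.

Lemma slope_continuous d t : 0 < d -> continuous (slope d) t.
Proof.
  intros Hd. unfold slope.
  assert (H0 : continuous (fun t => Rmax t 0) t) by apply continuous_Rmax_l.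
  apply (continuous_scal_r (V := R_NormedModule) (-2)), continuous_sqrt_comp.
  apply (continuous_mult (K := R_AbsRing)).
  - apply (continuous_comp (fun t => 1 - Rmax t 0) (fun y => Rmax y 0)).
    + apply (continuous_minus (V := R_NormedModule) (fun _ => 1)); [apply continuous_const | assumption].
    + apply continuous_Rmax_l.
  - apply continuous_Rinv_comp.
    + apply (continuous_scal_r (V := R_NormedModule) (1 + d)).
      apply (continuous_plus (V := R_NormedModule)); [assumption | apply continuous_const].
    + pose proof (Rmax_r t 0). apply Rmult_integral_contrapositive_currified; lra.
Qed.

Lemma slope_bounds d t : 0 < d -> - (2 / sqrt d) <= slope d t <= 0.
Proof.
  intros Hd. unfold slope.
  assert (Hs : 0 < sqrt d) by now apply sqrt_lt_R0.
  pose proof (Rmax_r t 0).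
  assert (Hratio : Rmax (1 - Rmax t 0) 0 / ((1 + d) * (Rmax t 0 + d)) <= / d).
  { assert (Hden : d <= (1 + d) * (Rmax t 0 + d)) by nra.
    apply Rle_trans with (1 * / ((1 + d) * (Rmax t 0 + d))).
    - apply Rmult_le_compat_r; [left; apply Rinv_0_lt_compat; lra |].
      apply Rmax_lub; lra.
    - rewrite Rmult_1_l. apply Rinv_le_contravar; lra. }
  apply sqrt_le_1_alt in Hratio. rewrite sqrt_inv in Hratio.
  pose proof (sqrt_pos (Rmax (1 - Rmax t 0) 0 / ((1 + d) * (Rmax t 0 + d)))).
  unfold Rdiv at 1. lra.
Qed.

Lemma slope_abs d t : 0 < d -> Rabs (slope d t) <= 2 / sqrt d.
Proof. intros Hd. pose proof (slope_bounds d t Hd). apply Rabs_le. lra. Qed.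

Lemma slope_sqr d t : 0 < d -> 0 <= t <= 1 ->
  slope d t ^ 2 = 4 * (1 - t) / ((1 + d) * (t + d)).
Proof.
  intros Hd Ht. unfold slope. rewrite (Rmax_left t), Rmax_left by lra.
  rewrite Rpow_mult_distr, pow2_sqrt; [field; lra |].
  apply Rdiv_le_0_compat; [lra |]. apply Rmult_lt_0_compat; lra.
Qed.

Lemma sqrt_gap_sqr d t : 0 < d -> 0 <= t <= 1 ->
  sqrt (gap_sqr d t) = - ((t + d) * slope d t).
Proof.
  intros Hd Ht. pose proof (slope_bounds d t Hd).
  apply sqrt_lem_1.
  - unfold gap_sqr. apply Rdiv_le_0_compat; [| lra]. apply Rmult_le_pos; nra.
  - nra.
  - replace (- ((t + d) * slope d t) * - ((t + d) * slope d t))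
      with ((t + d) ^ 2 * slope d t ^ 2) by ring.
    rewrite slope_sqr by assumption. unfold gap_sqr. field. lra.
Qed.

Lemma slope_gap d t : 0 < d -> 0 <= t <= 1 ->
  slope d t * sqrt (gap_sqr d t) = - (4 * (1 - t) / (1 + d)).
Proof.
  intros Hd Ht. rewrite sqrt_gap_sqr by assumption.
  replace (slope d t * - ((t + d) * slope d t)) with (- ((t + d) * slope d t ^ 2)) by ring.
  rewrite slope_sqr by assumption. field. lra.
Qed.

Lemma gap_sqr_derive d t : 0 < d ->
  is_derive (gap_sqr d) t (4 * (1 - d - 2 * t) / (1 + d)).
Proof. intros Hd. unfold gap_sqr. auto_derive; trivial. field. lra. Qed.

Lemma gap_sqr_lower d s t : 0 < d -> 0 <= s <= t -> t <= 1 ->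
  4 * d * (1 - t) / (1 + d) <= gap_sqr d s.
Proof.
  intros Hd Hs Ht. unfold gap_sqr. apply Rmult_le_compat_r.
  - left. apply Rinv_0_lt_compat. lra.
  - nra.
Qed.

Lemma delay_range d t : 0 <= Rmin (Rmax ((t - d) / d) 0) 1 <= 1.
Proof.
  split; [apply Rmin_glb; [apply Rmax_r | lra] | apply Rmin_r].
Qed.

Lemma delayed_slope_continuous d t : 0 < d -> continuous (delayed_slope d) t.
Proof.
  intros Hd. unfold delayed_slope.
  apply (continuous_mult (K := R_AbsRing)); [now apply slope_continuous |].
  apply (continuous_comp (fun t => Rmax ((t - d) / d) 0) (fun y => Rmin y 1)).
  - apply (continuous_comp (fun t => (t - d) / d) (fun y => Rmax y 0)).
    + apply (ex_derive_continuous (fun t => (t - d) / d)). auto_derive. lra.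
    + apply continuous_Rmax_l.
  - apply (continuous_Lipschitz (fun y => Rmin y 1) 1). intros a b.
    change (Rabs (Rmin b 1 - Rmin a 1) <= 1 * Rabs (b - a)).
    unfold Rmin, Rabs. repeat destruct Rle_dec; repeat destruct Rcase_abs; lra.
Qed.

Lemma delayed_slope_abs d t : 0 < d -> Rabs (delayed_slope d t) <= 2 / sqrt d.
Proof.
  intros Hd. unfold delayed_slope. rewrite Rabs_mult.
  pose proof (delay_range d t). rewrite (Rabs_pos_eq (Rmin _ _)) by lra.
  pose proof (slope_abs d t Hd). pose proof (Rabs_pos (slope d t)). nra.
Qed.

Lemma delayed_slope_early d t : 0 < d -> t <= d -> delayed_slope d t = 0.
Proof.
  intros Hd Ht. unfold delayed_slope.
  rewrite (Rmax_right ((t - d) / d)), Rmin_left; [ring | lra |].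
  apply Rle_div_nonneg; lra.
Qed.

Lemma delayed_slope_late d t : 0 < d -> 2 * d <= t -> delayed_slope d t = slope d t.
Proof.
  intros Hd Ht. unfold delayed_slope.
  rewrite Rmin_right; [ring |]. apply Rle_trans with (2 := Rmax_l _ _).
  apply (Rle_div_r 1); lra.
Qed.

Lemma driver_derive v t : (forall t, continuous v t) -> is_derive (driver v) t (v t).
Proof. intros H. now apply (is_derive_RInt_upper v). Qed.

Lemma driver_0 v : driver v 0 = 0.
Proof. apply (RInt_point (V := R_CompleteNormedModule)). Qed.

Lemma driver_simple v d : 0 < d ->
  (forall t, continuous v t) -> (forall t, Rabs (v t) <= 2 / sqrt d) ->
  simple_drivers0 1 (driver v).
Proof.
  intros Hd Hc Hb.
  assert (Hs : 0 < sqrt d) by now apply sqrt_lt_R0.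
  split; [split | apply driver_0].
  - apply continuous_on_forall. intros t _.
    apply (is_derive_continuous _ _ (v t)), driver_derive, Hc.
  - apply (simple_curve_of_bounded_derivative v (driver v) (sqrt d / 2)); auto; try lra.
    + intros t. apply Rle_trans with (2 / sqrt d * (sqrt d / 2)).
      * apply Rmult_le_compat_r; [lra | apply Hb].
      * right. field. lra.
    + intros t. now apply driver_derive.
Qed.

Lemma gap_hits_at_1 d : 0 < d ->
  is_hitting 1 (driver (slope d)) (sqrt (gap_sqr d 0)) 1.
Proof.
  intros Hd. split; [unfold Icc; lra |].
  exists (fun t => driver (slope d) t + sqrt (gap_sqr d t)).
  assert (Hpos : forall t, 0 <= t < 1 -> 0 < gap_sqr d t).
  { intros t Ht. unfold gap_sqr. apply Rdiv_lt_0_compat; [| lra].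
    apply Rmult_lt_0_compat; lra. }
  split; [split |].
  - rewrite driver_0. ring.
  - intros t Ht. unfold Ico in Ht.
    pose proof (sqrt_lt_R0 _ (Hpos t Ht)) as Hsq. split; [lra |].
    apply is_derive_within_of_is_derive; [exact Ht |].
    replace (-2 / _) with (slope d t + (4 * (1 - d - 2 * t) / (1 + d)) / (2 * sqrt (gap_sqr d t))).
    + apply (is_derive_plus (V := R_NormedModule)).
      * apply driver_derive. intros. now apply slope_continuous.
      * apply (is_derive_sqrt (gap_sqr d)); auto. now apply gap_sqr_derive.
    + replace (driver (slope d) t + sqrt (gap_sqr d t) - driver (slope d) t)
        with (sqrt (gap_sqr d t)) by ring.
      replace (slope d t) with (slope d t * sqrt (gap_sqr d t) / sqrt (gap_sqr d t)) by (field; lra).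
      rewrite slope_gap by lra. field. lra.
  - apply LimInf_left_eq_0.
    + intros. apply Rabs_pos.
    + intros eps delta He Hdl.
      set (s := 1 - Rmin (Rmin (delta / 2) (1 / 2)) (eps ^ 2 / 8)).
      assert (He2 : 0 < eps ^ 2) by (now apply pow_lt).
      assert (Hm : 0 < Rmin (Rmin (delta / 2) (1 / 2)) (eps ^ 2 / 8))
        by (repeat apply Rmin_glb_lt; lra).
      pose proof (Rmin_l (Rmin (delta / 2) (1 / 2)) (eps ^ 2 / 8)).
      pose proof (Rmin_r (Rmin (delta / 2) (1 / 2)) (eps ^ 2 / 8)).
      pose proof (Rmin_l (delta / 2) (1 / 2)). pose proof (Rmin_r (delta / 2) (1 / 2)).
      exists s. unfold Ico. split; [unfold s; lra |]. split; [unfold s; lra |].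
      replace (driver (slope d) s + sqrt (gap_sqr d s) - driver (slope d) s)
        with (sqrt (gap_sqr d s)) by ring.
      rewrite Rabs_pos_eq by apply sqrt_pos.
      rewrite <- (sqrt_pow2 eps) by lra. apply sqrt_lt_1_alt.
      assert (Hs : 0 <= s < 1) by (unfold s; lra).
      split; [left; now apply Hpos |].
      apply Rle_lt_trans with (4 * (1 - s)); [| unfold s; lra].
      unfold gap_sqr. apply Rle_div_nonneg; [lra |]. nra.
Qed.

(** For a solution at distance [w] from the driver, [P = w ^ 2 - gap_sqr]
    satisfies [P' = - 2 xi' P / (w + sqrt gap_sqr)], where the denominator is
    bounded below before time [1]; hence [P = 0]. *)
Lemma gap_unique d t g : 0 < d -> 0 < t < 1 ->
  is_real_loewner_solution (Ico 0 t) (driver (slope d)) (sqrt (gap_sqr d 0)) g ->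
  forall s, 0 < s < t -> (g s - driver (slope d) s) ^ 2 = gap_sqr d s.
Proof.
  intros Hd Ht [Hg0 Hg].
  set (w := fun s => g s - driver (slope d) s).
  assert (Hcd : forall s, continuous (driver (slope d)) s).
  { intros s. apply (is_derive_continuous _ _ (slope d s)), driver_derive.
    intros; now apply slope_continuous. }
  assert (Hq0 : 0 < gap_sqr d 0).
  { unfold gap_sqr. apply Rdiv_lt_0_compat; lra. }
  assert (Hw : forall s, 0 < s < t -> is_derive w s (- 2 / w s - slope d s)).
  { intros s Hs. destruct (Hg s) as [_ Hds]; [unfold Ico; lra |].
    apply (is_derive_minus (V := R_NormedModule) g).
    - apply (is_derive_of_within_interior (Ico 0 t)); [| exact Hds].
      assert (Hm : 0 < Rmin s (t - s)) by (apply Rmin_glb_lt; lra).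
      exists (mkposreal _ Hm). intros r Hr. change (Rabs (r - s) < Rmin s (t - s)) in Hr.
      pose proof (Rmin_l s (t - s)). pose proof (Rmin_r s (t - s)).
      apply Rabs_def2 in Hr. unfold Ico. lra.
    - apply driver_derive. intros; now apply slope_continuous. }
  (* One-sided continuity at time 0 becomes two-sided after the solution is
     extended by its initial value. *)
  set (wext := fun s => g (Rmax s 0) - driver (slope d) s).
  assert (Hext : forall s, 0 < s -> wext s = w s).
  { intros s Hs. unfold wext, w. now rewrite Rmax_left by lra. }
  assert (Hext0 : wext 0 = sqrt (gap_sqr d 0)).
  { unfold wext. rewrite Rmax_left, driver_0, Hg0 by lra. ring. }
  assert (Hcext : continuous wext 0).
  { apply (continuous_minus (V := R_NormedModule)); [| apply Hcd].
    destruct (Hg 0) as [_ H0]; [unfold Ico; lra |].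
    now apply (right_continuous_of_derive_within g t _ (proj1 Ht)) in H0. }
  assert (Hnear : forall Q : R -> Prop, locally 0 Q -> forall s, 0 < s -> exists r, 0 < r < s /\ Q r).
  { intros Q [e HQ] s Hs. pose proof (cond_pos e).
    assert (0 < Rmin (e / 2) (s / 2)) by (apply Rmin_glb_lt; lra).
    pose proof (Rmin_l (e / 2) (s / 2)). pose proof (Rmin_r (e / 2) (s / 2)).
    exists (Rmin (e / 2) (s / 2)). split; [lra |]. apply HQ.
    change (Rabs (Rmin (e / 2) (s / 2) - 0) < e). rewrite Rminus_0_r, Rabs_pos_eq; lra. }
  assert (Hwpos : forall s, 0 < s < t -> 0 < w s).
  { intros s Hs. apply Rnot_le_lt. intros Hle.
    assert (Hne : forall r, 0 < r < t -> w r <> 0).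
    { intros r Hr. destruct (Hg r) as [Hn _]; [unfold Ico; lra |]. unfold w. lra. }
    assert (Hlt : w s < 0) by (pose proof (Hne s Hs); lra).
    destruct (Hnear (fun r => 0 < wext r)) with (s := s) as (r & Hr & Hwr); [| lra |].
    { apply (Hcext (fun y => 0 < y)). apply (open_gt 0). rewrite Hext0. now apply sqrt_lt_R0. }
    rewrite Hext in Hwr by lra.
    destruct (IVT_interv (fun q => - w q) r s) as [z [Hz Ez]]; try lra.
    - intros q Hq. apply continuity_pt_filterlim.
      apply (continuous_opp (V := R_NormedModule) w).
      apply (is_derive_continuous w q (- 2 / w q - slope d q)), Hw. lra.
    - apply (Hne z); lra. }
  intros s Hs. fold (w s).
  set (m := sqrt (4 * d * (1 - t) / (1 + d))).
  assert (Hm : 0 < m).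
  { apply sqrt_lt_R0. apply Rdiv_lt_0_compat; [| lra]. apply Rmult_lt_0_compat; lra. }
  assert (Hmq : forall r, 0 <= r <= t -> m <= sqrt (gap_sqr d r)).
  { intros r Hr. apply sqrt_le_1_alt, gap_sqr_lower; lra. }
  assert (Hsd : 0 < sqrt d) by (now apply sqrt_lt_R0).
  set (K := 8 / (sqrt d * m)).
  assert (HK : 0 < K) by (apply Rdiv_lt_0_compat; [lra | now apply Rmult_lt_0_compat]).
  set (Phi := fun r => (wext r ^ 2 - gap_sqr d r) ^ 2).
  assert (HPhi0 : Phi 0 = 0).
  { unfold Phi. rewrite Hext0, pow2_sqrt by lra. ring. }
  assert (HcPhi : continuous Phi 0).
  { assert (Hc1 : continuous (fun r => wext r ^ 2 - gap_sqr d r) 0).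
    { apply (continuous_minus (V := R_NormedModule)).
      - apply (continuous_comp wext (fun y => y ^ 2)); [assumption |].
        apply (ex_derive_continuous (fun y => y ^ 2)). auto_derive. trivial.
      - apply (is_derive_continuous _ _ _ (gap_sqr_derive d 0 Hd)). }
    apply (continuous_comp (fun r => wext r ^ 2 - gap_sqr d r) (fun y => y ^ 2)); [assumption |].
    apply (ex_derive_continuous (fun y => y ^ 2)). auto_derive. trivial. }
  assert (Hgr : forall r, 0 < r < s -> (w s ^ 2 - gap_sqr d s) ^ 2 <= exp (K * s) * Phi r).
  { intros r Hr.
    assert (E : (w s ^ 2 - gap_sqr d s) ^ 2
                <= exp (K * (s - r)) * (w r ^ 2 - gap_sqr d r) ^ 2).
    { apply (gronwall_forward (fun q => (w q ^ 2 - gap_sqr d q) ^ 2) (fun q =>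
        2 * (w q ^ 2 - gap_sqr d q) *
          (2 * w q * (- 2 / w q - slope d q) - 4 * (1 - d - 2 * q) / (1 + d)))); [lra | |].
      - intros q Hq. apply (is_derive_sqr (fun q => w q ^ 2 - gap_sqr d q)).
        apply (is_derive_minus (V := R_NormedModule) (fun q => w q ^ 2) (gap_sqr d)).
        + apply is_derive_sqr, Hw. lra.
        + now apply gap_sqr_derive.
      - intros q Hq.
        pose proof (Hwpos q ltac:(lra)) as Hwq. pose proof (Hmq q ltac:(lra)) as Hmq'.
        pose proof (slope_gap d q Hd ltac:(lra)) as Hsg.
        pose proof (slope_bounds d q Hd) as Hsb.
        set (z := sqrt (gap_sqr d q)) in *.
        assert (Hz2 : gap_sqr d q = z ^ 2).
        { unfold z. rewrite pow2_sqrt; [reflexivity |].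
          apply Rle_trans with (2 := gap_sqr_lower d q t Hd ltac:(lra) ltac:(lra)).
          apply Rdiv_le_0_compat; [| lra]. apply Rmult_le_pos; lra. }
        rewrite Hz2.
        replace (2 * w q * (- 2 / w q - slope d q) - 4 * (1 - d - 2 * q) / (1 + d))
          with (- 2 * slope d q * (w q - z)).
        2: { replace (- 2 * slope d q * (w q - z))
               with (2 * (slope d q * z) - 2 * slope d q * w q) by ring.
             rewrite Hsg. field. lra. }
        assert (HKm : 8 / sqrt d <= K * (w q + z)).
        { apply Rle_trans with (K * m); [right; unfold K; field; lra |].
          apply Rmult_le_compat_l; lra. }
        replace (2 * (w q ^ 2 - z ^ 2) * (-2 * slope d q * (w q - z)))
          with ((- 4 * slope d q) * ((w q - z) ^ 2 * (w q + z))) by ring.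
        replace (K * (w q ^ 2 - z ^ 2) ^ 2)
          with (K * (w q + z) * ((w q - z) ^ 2 * (w q + z))) by ring.
        apply Rmult_le_compat_r.
        + apply Rmult_le_pos; [apply pow2_ge_0 | lra].
        + unfold Rdiv in *. lra. }
    apply Rle_trans with (1 := E). unfold Phi. rewrite Hext by lra.
    apply Rmult_le_compat_r; [apply pow2_ge_0 |]. apply exp_monotone.
    apply Rmult_le_compat_l; lra. }
  assert (Hzero : (w s ^ 2 - gap_sqr d s) ^ 2 <= 0).
  { apply le_epsilon. intros eps Heps. rewrite Rplus_0_l.
    assert (HE : 0 < exp (K * s)) by apply exp_pos.
    destruct (Hnear (fun r => Phi r < eps / exp (K * s))) with (s := s) as (r & Hr & Hlt); [| lra |].
    { apply (HcPhi (fun y => y < eps / exp (K * s))). apply (open_lt (eps / exp (K * s))).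
      rewrite HPhi0. now apply Rdiv_lt_0_compat. }
    apply Rle_trans with (1 := Hgr r Hr).
    apply Rle_trans with (exp (K * s) * (eps / exp (K * s))); [| right; field; lra].
    apply Rmult_le_compat_l; lra. }
  pose proof (pow2_ge_0 (w s ^ 2 - gap_sqr d s)).
  apply Rminus_diag_uniq, Rsqr_0_uniq. unfold Rsqr. lra.
Qed.

Lemma driver_hitting_time d : 0 < d ->
  hitting_time 1 (driver (slope d)) (sqrt (gap_sqr d 0)) = Finite 1.
Proof.
  intros Hd.
  assert (Hq0 : 0 < sqrt (gap_sqr d 0)).
  { apply sqrt_lt_R0. unfold gap_sqr. apply Rdiv_lt_0_compat; lra. }
  unfold hitting_time. rewrite driver_0.
  destruct (Req_EM_T _ 0) as [E | _]; [lra |].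
  apply is_glb_Rbar_unique. split.
  - intros t [Ht (g & Hg & Hlim)]. unfold Icc in Ht. simpl.
    apply Rnot_lt_le. intros Hlt.
    set (m := Rmin (sqrt (4 * d * (1 - t) / (1 + d))) (sqrt (gap_sqr d 0))).
    assert (Hm : 0 < m).
    { apply Rmin_glb_lt; [| assumption].
      apply sqrt_lt_R0, Rdiv_lt_0_compat; [| lra]. apply Rmult_lt_0_compat; lra. }
    revert Hlim. apply (LimInf_left_neq_0 _ _ _ m Hm).
    intros s Hs. unfold Ico in Hs.
    destruct (Rle_lt_or_eq_dec 0 s (proj1 Hs)) as [Hps | <-].
    + apply Rle_trans with (1 := Rmin_l _ _).
      rewrite <- sqrt_Rsqr_abs. apply sqrt_le_1_alt.
      replace (Rsqr (g s - driver (slope d) s)) with ((g s - driver (slope d) s) ^ 2)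
        by (unfold Rsqr; ring).
      rewrite (gap_unique d t g Hd ltac:(lra) Hg s) by lra.
      apply gap_sqr_lower; lra.
    + rewrite (proj1 Hg), driver_0, Rminus_0_r, Rabs_pos_eq by lra. apply Rmin_r.
  - intros b Hb. apply Hb. now apply gap_hits_at_1.
Qed.

Lemma delayed_driver_early d t : 0 < d -> 0 <= t <= d -> driver (delayed_slope d) t = 0.
Proof.
  intros Hd Ht. unfold driver.
  rewrite (RInt_ext _ (fun _ => 0)).
  - rewrite RInt_const. unfold scal; simpl. unfold mult; simpl. ring.
  - intros s Hs. rewrite Rmin_left, Rmax_right in Hs by lra.
    apply delayed_slope_early; lra.
Qed.

(** While the driver stands still at [0], the solution is
    [sqrt (gap_sqr d 0 - 4 t)]. *)
Lemma delayed_driver_hits d : 0 < d ->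
  is_hitting 1 (driver (delayed_slope d)) (sqrt (gap_sqr d 0)) (d / (1 + d)).
Proof.
  intros Hd.
  assert (Ht1 : 0 < d / (1 + d)) by (apply Rdiv_lt_0_compat; lra).
  assert (Ht1d : d / (1 + d) <= d) by (apply Rle_div_nonneg; nra).
  assert (Ht11 : d / (1 + d) <= 1) by (apply Rle_div_nonneg; lra).
  assert (Hq0 : gap_sqr d 0 = 4 * (d / (1 + d))) by (unfold gap_sqr; field; lra).
  set (t1 := d / (1 + d)) in *.
  split; [unfold Icc; lra |].
  exists (fun t => sqrt (gap_sqr d 0 - 4 * t)). split; [split |].
  - now rewrite Rmult_0_r, Rminus_0_r.
  - intros t Ht. unfold Ico in Ht.
    rewrite (delayed_driver_early d t) by lra.
    assert (Hpos : 0 < gap_sqr d 0 - 4 * t) by lra.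
    pose proof (sqrt_lt_R0 _ Hpos). split; [lra |].
    apply is_derive_within_of_is_derive; [exact Ht |].
    replace (-2 / _) with (- (4) / (2 * sqrt (gap_sqr d 0 - 4 * t))) by (field; lra).
    apply (is_derive_sqrt (fun t => gap_sqr d 0 - 4 * t)); [| assumption].
    auto_derive; trivial. ring.
  - apply LimInf_left_eq_0.
    + intros. apply Rabs_pos.
    + intros eps delta He Hdl.
      assert (He2 : 0 < eps ^ 2) by (now apply pow_lt).
      set (m := Rmin (Rmin (delta / 2) (t1 / 2)) (eps ^ 2 / 8)).
      assert (Hm : 0 < m) by (repeat apply Rmin_glb_lt; lra).
      assert (m <= Rmin (delta / 2) (t1 / 2)) by apply Rmin_l.
      assert (m <= eps ^ 2 / 8) by apply Rmin_r.
      pose proof (Rmin_l (delta / 2) (t1 / 2)). pose proof (Rmin_r (delta / 2) (t1 / 2)).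
      exists (t1 - m). unfold Ico. split; [lra |]. split; [lra |].
      rewrite (delayed_driver_early d) by lra.
      rewrite Rminus_0_r, Rabs_pos_eq by apply sqrt_pos.
      rewrite <- (sqrt_pow2 eps) by lra. apply sqrt_lt_1_alt. lra.
Qed.

Lemma delayed_driver_hitting_time d : 0 < d ->
  exists r, 0 <= r <= d /\
  hitting_time 1 (driver (delayed_slope d)) (sqrt (gap_sqr d 0)) = Finite r.
Proof.
  intros Hd.
  assert (Hq0 : 0 < sqrt (gap_sqr d 0)).
  { apply sqrt_lt_R0. unfold gap_sqr. apply Rdiv_lt_0_compat; lra. }
  assert (Ht1d : d / (1 + d) <= d) by (apply Rle_div_nonneg; nra).
  unfold hitting_time. rewrite driver_0.
  destruct (Req_EM_T _ 0) as [E | _]; [lra |].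
  set (S := is_hitting 1 (driver (delayed_slope d)) (sqrt (gap_sqr d 0))).
  destruct (Glb_Rbar_correct S) as [Hlb Hglb].
  pose proof (Hlb _ (delayed_driver_hits d Hd)) as H1.
  assert (H0 : Rbar_le (Finite 0) (Glb_Rbar S)).
  { apply Hglb. intros t [Ht _]. exact (proj1 Ht). }
  destruct (Glb_Rbar S) as [r | |]; try contradiction.
  exists r. simpl in H0, H1. split; [lra | reflexivity].
Qed.

(** The slopes differ only before time [2 d], and by at most [2 / sqrt d]. *)
Lemma drivers_close d t : 0 < d -> 0 <= t ->
  Rabs (driver (slope d) t - driver (delayed_slope d) t) <= 4 * sqrt d.
Proof.
  intros Hd Ht.
  assert (Hs : 0 < sqrt d) by now apply sqrt_lt_R0.
  assert (Hc1 : forall t, continuous (slope d) t) by (intros; now apply slope_continuous).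
  assert (Hc2 : forall t, continuous (delayed_slope d) t)
    by (intros; now apply delayed_slope_continuous).
  set (f := fun s => slope d s - delayed_slope d s : R).
  assert (Hcf : forall t, continuous f t).
  { intros s. now apply (continuous_minus (V := R_NormedModule)). }
  assert (E : driver (slope d) t - driver (delayed_slope d) t = RInt f 0 t).
  { symmetry. apply (RInt_minus (V := R_CompleteNormedModule) (slope d) (delayed_slope d));
      now apply (continuous_ex_RInt (V := R_CompleteNormedModule)). }
  rewrite E.
  assert (Hearly : forall r, 0 <= r <= 2 * d -> Rabs (RInt f 0 r) <= 4 * sqrt d).
  { intros r Hr.
    apply Rle_trans with ((r - 0) * (2 / sqrt d)).
    - apply abs_RInt_le_const; [lra | now apply (continuous_ex_RInt (V := R_CompleteNormedModule)) |].
      intros s _. unfold f, delayed_slope.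
      pose proof (slope_bounds d s Hd). pose proof (delay_range d s).
      apply Rabs_le. nra.
    - apply Rle_trans with (2 * d * (2 / sqrt d)).
      + apply Rmult_le_compat_r; [| lra]. apply Rdiv_le_0_compat; lra.
      + right. replace d with (sqrt d * sqrt d) at 1 by (apply sqrt_sqrt; lra). field. lra. }
  destruct (Rle_dec t (2 * d)) as [Hle | Hle]; [apply Hearly; lra |].
  rewrite <- (RInt_Chasles (V := R_CompleteNormedModule) f 0 (2 * d) t)
    by (now apply (continuous_ex_RInt (V := R_CompleteNormedModule))).
  rewrite (RInt_ext f (fun _ => 0) (2 * d) t).
  - rewrite RInt_const. unfold plus, scal; simpl. unfold mult; simpl.
    rewrite Rmult_0_r, Rplus_0_r. apply Hearly; lra.
  - intros s Hst. rewrite Rmin_left in Hst by lra.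
    unfold f. rewrite delayed_slope_late by lra. apply Rminus_diag.
Qed.

Lemma sup_norm_bounds T f M : 0 <= T -> (forall t, 0 <= t <= T -> Rabs (f t) <= M) ->
  0 <= sup_norm T f <= M.
Proof.
  intros HT H. unfold sup_norm.
  set (S := fun y => exists t, Icc 0 T t /\ y = Rabs (f t)).
  destruct (Lub_Rbar_correct S) as [Hub Hlub].
  assert (HM : Rbar_le (Lub_Rbar S) (Finite M)).
  { apply Hlub. intros y (t & Ht & ->). now apply H. }
  assert (H0 : Rbar_le (Finite (Rabs (f 0))) (Lub_Rbar S)).
  { apply Hub. exists 0. split; [unfold Icc; lra | reflexivity]. }
  destruct (Lub_Rbar S) as [r | |]; try contradiction.
  simpl in HM, H0 |- *. pose proof (Rabs_pos (f 0)). lra.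
Qed.

Theorem lemma3p6 :
  exists T : R, 0 < T /\
  exists (xi xi' : nat -> R -> R) (y : nat -> R) (eps : R),
    (forall n, simple_drivers0 T (xi n) /\ simple_drivers0 T (xi' n)) /\
    is_lim_seq (fun n => sup_norm T (fun t => xi n t - xi' n t)) (Finite 0) /\
    0 < eps /\
    forall n,
      Rbar_lt (hitting_time T (xi n) (y n)) p_infty /\
      Rbar_lt (hitting_time T (xi' n) (y n)) p_infty /\
      Rbar_le (Finite eps)
        (Rbar_abs (Rbar_minus (hitting_time T (xi n) (y n))
                              (hitting_time T (xi' n) (y n)))).
Proof.
  set (e := fun n : nat => 1 / 2 * (1 / 2) ^ n).
  assert (He : forall n, 0 < e n <= 1 / 2).
  { intros n. unfold e.
    assert (0 < (1 / 2) ^ n) by (apply pow_lt; lra).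
    assert ((1 / 2) ^ n <= 1) by (apply Rle_trans with (1 ^ n);
      [apply pow_incr; lra | rewrite pow1; lra]). lra. }
  assert (Hd : forall n, 0 < e n ^ 2 <= 1 / 2) by (intros n; pose proof (He n); nra).
  exists 1. split; [lra |].
  exists (fun n => driver (slope (e n ^ 2))), (fun n => driver (delayed_slope (e n ^ 2))),
    (fun n => sqrt (gap_sqr (e n ^ 2) 0)), (1 / 2).
  split; [| split; [| split]].
  - intros n. destruct (Hd n) as [Hpos _]. split; apply (driver_simple _ _ Hpos); intros t.
    + now apply slope_continuous.
    + now apply slope_abs.
    + now apply delayed_slope_continuous.
    + now apply delayed_slope_abs.
  - apply is_lim_seq_le_le with (u := fun _ => 0) (w := fun n => 2 * (1 / 2) ^ n).
    + intros n. destruct (Hd n) as [Hpos _]. pose proof (He n).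
      replace (2 * (1 / 2) ^ n) with (4 * sqrt (e n ^ 2)).
      * apply sup_norm_bounds; [lra |]. intros t Ht. now apply drivers_close.
      * rewrite sqrt_pow2 by lra. unfold e. field.
    + apply is_lim_seq_const.
    + replace (Finite 0) with (Rbar_mult 2 (Finite 0)) by (simpl; f_equal; ring).
      apply is_lim_seq_scal_l, is_lim_seq_geom. rewrite Rabs_pos_eq; lra.
  - lra.
  - intros n. destruct (Hd n) as [Hpos Hle].
    rewrite driver_hitting_time by assumption.
    destruct (delayed_driver_hitting_time (e n ^ 2) Hpos) as (r & Hr & ->).
    split; [exact I |]. split; [exact I |].
    simpl. rewrite Rabs_pos_eq; lra.
Qed.
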